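(* Let $E$ be a vector bundle over a smooth manifold $M$. If $\mathrm{rank}(E)>1$, then Lie QD-algebroids on $E$ are exactly Lie algebroids on $E$. If $\mathrm{rank}(E)=1$, then Lie QD-algebroids on $E$ are exactly local Lie algebras (on the sections of $E$) in the sense of Kirillov.
   Context: $\mathcal{E}=\mathrm{Sec}(E)$ is the $C^\infty(M)$-module of smooth sections of the real vector bundle $E$, whose fibers all have the same finite dimension $\mathrm{rank}(E)$. An $\mathbb{R}$-linear operator $D:\mathcal{E}\to\mathcal{E}$ is a quasi-derivation if for each $f\in C^\infty(M)$ there is $\widehat{D}(f)\in C^\infty(M)$ such that $D(fX)=fD(X)+\widehat{D}(f)X$ for all $X\in\mathcal{E}$. A Lie QD-algebroid on $E$ is a real Lie algebra bracket $[\cdot,\cdot]$ on $\mathcal{E}$ which is a quasi-derivation with respect to each argument separately. A Lie algebroid on $E$ is an $\mathbb{R}$-bilinear, alternating bracket on $\mathcal{E}$ satisfying the Jacobi identity, for which there is a $C^\infty(M)$-linear map (anchor) $a:\mathcal{E}\to\mathrm{Der}(C^\infty(M))$ (equivalently, a vector bundle morphism $a:E\to TM$ over the identity) such that $[X,fY]=f[X,Y]+a(X)(f)Y$ and $a([X,Y])=[a(X),a(Y)]$ (commutator of derivations) for all $X,Y\in\mathcal{E}$, $f\in C^\infty(M)$. A local Lie algebra in the sense of Kirillov on a line bundle $E$ is a real Lie algebra bracket on $\mathrm{Sec}(E)$ that is local, i.e. $\mathrm{supp}[X,Y]\subset\mathrm{supp}\,X\cap\mathrm{supp}\,Y$ for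 all sections $X,Y$. *)

(* Defs.v *)
From HB Require Import structures.
From mathcomp Require Import all_boot all_order all_algebra.
From mathcomp Require Import all_classical all_reals all_analysis.

Set Implicit Arguments.
Unset Strict Implicit.
Unset Printing Implicit Defensive.

Import Order.TTheory GRing.Theory Num.Theory.
Import numFieldNormedType.Exports.

Local Open Scope classical_set_scope.
Local Open Scope ring_scope.

Section smooth_euclidean.
Context {R : realType} {n : nat}.
Implicit Types (U V : set 'rV[R]_n) (f g : 'rV[R]_n -> R).

(* [f] has continuous iterated partial derivatives up to order [k] on [U].
   Meant for open [U]: only the values of [f] near points of [U] matter. *)
Fixpoint Ck_on (k : nat) U f : Prop :=
  {in U, continuous f} /\
  match k with
  | 0 => True
  | k'.+1 => forall i : 'I_n,
      {in U, forall x, derivable f x (delta_mx 0 i)} /\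
      Ck_on k' U ('D_(delta_mx 0 i) f)
  end.

Definition smooth_on U f : Prop := forall k, Ck_on k U f.

Lemma Ck_on_continuous k U f : Ck_on k U f -> {in U, continuous f}.
Proof. by case: k => [|k] []. Qed.

Lemma Ck_on_subset k U V f : U `<=` V -> Ck_on k V f -> Ck_on k U f.
Proof.
move=> UV; have sub x : x \in U -> x \in V by rewrite !inE => /UV.
elim: k f => [|k IH] f [cf df]; split=> //; first by move=> x /sub /cf.
  by move=> x /sub /cf.
by move=> i; have [dfi Di] := df i; split=> [x /sub /dfi //|]; exact: IH.
Qed.

Lemma Ck_onW k U f : Ck_on k.+1 U f -> Ck_on k U f.
Proof.
elim: k f => [|k IH] f [cf df]; split=> // i.
by have [dfi Di] := df i; split=> //; exact: IH.
Qed.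

Lemma eq_Ck_on k U f g : open U -> {in U, f =1 g} -> Ck_on k U f -> Ck_on k U g.
Proof.
move=> oU; elim: k f g => [|k IH] f g fg [cf df].
all: have fgn x : x \in U -> \forall y \near x, f y = g y
  by exact: open_in_nearW.
all: have cg : {in U, continuous g} by move=> x xU; rewrite /continuous_at -fg//;
  apply: cvg_trans (cf x xU); exact: (@near_eq_cvg _ _ (nbhs x) _ f g (fgn x xU)).
all: split=> // i; have [dfi Di] := df i; split.
  by move=> x xU; apply: near_eq_derivable (dfi x xU); exact: fgn.
by apply: IH Di => x xU; apply: near_eq_derive; exact: fgn.
Qed.

Lemma Ck_on_cst k U (a : R) : open U -> Ck_on k U (cst a).
Proof.
move=> oU; elim: k a => [|k IH] a.
all: split=> [x _|//]; first exact: cst_continuous.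
move=> i; split=> [x _|]; first exact: derivable_cst.
by apply: eq_Ck_on (IH 0) => // x _; rewrite derive_cst.
Qed.

Lemma Ck_onD k U f g : open U -> Ck_on k U f -> Ck_on k U g -> Ck_on k U (f + g).
Proof.
move=> oU; elim: k f g => [|k IH] f g [cf df] [cg dg].
  by split=> // x xU; apply: continuousD; [exact: cf|exact: cg].
split=> [x xU|i]; first by apply: continuousD; [exact: cf|exact: cg].
have [dfi Dfi] := df i; have [dgi Dgi] := dg i.
split=> [x xU|]; first by apply: derivableD; [exact: dfi|exact: dgi].
apply: eq_Ck_on (IH _ _ Dfi Dgi) => // x xU.
by rewrite deriveD//; [exact: dfi|exact: dgi].
Qed.

Lemma Ck_onM k U f g : open U -> Ck_on k U f -> Ck_on k U g -> Ck_on k U (f * g).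
Proof.
move=> oU; elim: k f g => [|k IH] f g Cf Cg.
  move: Cf Cg => [cf _] [cg _].
  by split=> // x xU; apply: continuousM; [exact: cf|exact: cg].
have Cf' := Ck_onW Cf; have Cg' := Ck_onW Cg.
move: Cf Cg => [cf df] [cg dg].
split=> [x xU|i]; first by apply: continuousM; [exact: cf|exact: cg].
have [dfi Dfi] := df i; have [dgi Dgi] := dg i.
split=> [x xU|]; first by apply: derivableM; [exact: dfi|exact: dgi].
apply: eq_Ck_on (Ck_onD oU (IH _ _ Cf' Dgi) (IH _ _ Cg' Dfi)) => // x xU.
by rewrite deriveM//; [exact: dfi|exact: dgi].
Qed.

End smooth_euclidean.

(* A homeomorphism [cmap] from the open set [cdom] of [M] onto the open set
   [cimg] of R^n, with inverse [cinv]; values off [cdom], [cimg] are junk. *)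
Record chart (R : realType) (n : nat) (M : topologicalType) := Chart {
  cdom : set M;
  cimg : set 'rV[R]_n;
  cmap : M -> 'rV[R]_n;
  cinv : 'rV[R]_n -> M;
  cdom_open : open cdom;
  cimg_open : open cimg;
  cmap_img : forall x, cdom x -> cimg (cmap x);
  cinv_dom : forall v, cimg v -> cdom (cinv v);
  cmapK : {in cdom, cancel cmap cinv};
  cinvK : {in cimg, cancel cinv cmap};
  cmap_continuous : {in cdom, continuous cmap};
  cinv_continuous : {in cimg, continuous cinv}
}.

(* The atlas need not be maximal: compatible atlases give the same smooth
   functions. *)
Record manifold (R : realType) (n : nat) := Manifold {
  carrier :> topologicalType;
  manifold_hausdorff : hausdorff_space carrier;
  manifold_second_countable : @second_countable carrier;
  atlas : set (chart R n carrier);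
  atlas_cover : forall x, exists2 c, atlas c & cdom c x;
  atlas_smooth : forall c d, atlas c -> atlas d -> forall i : 'I_n,
    smooth_on (cimg c `&` cinv c @^-1` cdom d)
              (fun v => cmap d (cinv c v) 0 i)
}.

Section smooth_functions.
Context {R : realType} {n : nat} {M : manifold R n}.
Implicit Types (U : set M) (f g : M -> R).

(* [f] restricts to a smooth function on the open set [U]. *)
Definition smooth_in U f : Prop :=
  forall c, atlas c -> smooth_on (cimg c `&` cinv c @^-1` U) (f \o cinv c).

Lemma chart_preimage_open (c : chart R n M) U :
  open U -> open (cimg c `&` cinv c @^-1` U).
Proof.
move=> oU; rewrite openE => v [cv Uv]; apply: filterI.
  by apply: open_nbhs_nbhs; split=> //; exact: cimg_open.
apply: (@cinv_continuous _ _ _ c v); first exact: mem_set.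
by apply: open_nbhs_nbhs.
Qed.

Lemma smooth_in_subset U V f : U `<=` V -> smooth_in V f -> smooth_in U f.
Proof.
move=> UV sf c ac k; apply: Ck_on_subset (sf c ac k).
by apply: setIS => v; exact: UV.
Qed.

Lemma smooth_in_cst U (a : R) : open U -> smooth_in U (cst a).
Proof. by move=> oU c _ k; apply: Ck_on_cst; exact: chart_preimage_open. Qed.

Lemma smooth_inD U f g :
  open U -> smooth_in U f -> smooth_in U g -> smooth_in U (f + g).
Proof.
move=> oU sf sg c ac k; apply: (Ck_onD _ (sf c ac k) (sg c ac k)).
exact: chart_preimage_open.
Qed.

Lemma smooth_inM U f g :
  open U -> smooth_in U f -> smooth_in U g -> smooth_in U (f * g).
Proof.
move=> oU sf sg c ac k; apply: (Ck_onM _ (sf c ac k) (sg c ac k)).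
exact: chart_preimage_open.
Qed.

Lemma eq_smooth_in U f g :
  open U -> {in U, f =1 g} -> smooth_in U f -> smooth_in U g.
Proof.
move=> oU fg sf c ac k; apply: eq_Ck_on (sf c ac k).
  exact: chart_preimage_open.
by move=> v /set_mem[_ Uv] /=; apply: fg; exact: mem_set.
Qed.

Definition smooth_pred : {pred M -> R} := [pred f | `[< smooth_in setT f >]].

Lemma smooth_pred_subring : subring_closed smooth_pred.
Proof.
split=> [|f g /asboolP sf /asboolP sg|f g /asboolP sf /asboolP sg];
  apply/asboolP.
- exact: smooth_in_cst openT.
- apply: smooth_inD => //; first exact: openT.
  have -> : - g = cst (-1) * g by apply/funext => x; rewrite /= !fctE mulN1r.
  by apply: smooth_inM => //; [exact: openT|exact: smooth_in_cst openT].
- exact: smooth_inM openT sf sg.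
Qed.

HB.instance Definition _ :=
  GRing.isSubringClosed.Build (M -> R) smooth_pred smooth_pred_subring.

Lemma smooth_pred_scaler : GRing.scaler_closed smooth_pred.
Proof.
move=> a f /asboolP sf; apply/asboolP.
exact: smooth_inM openT (smooth_in_cst a openT) sf.
Qed.

HB.instance Definition _ :=
  GRing.isScaleClosed.Build R (M -> R) smooth_pred smooth_pred_scaler.

End smooth_functions.
Arguments smooth_pred {R n} M.

(* The algebra C^oo(M); it is the zero ring when M is empty. *)
Record Cinf (R : realType) (n : nat) (M : manifold R n) := MkCinf {
  Cinf_val :> M -> R;
  Cinf_smooth : Cinf_val \in smooth_pred M
}.

Section Cinf_algebra.
Context {R : realType} {n : nat} {M : manifold R n}.
HB.instance Definition _ := [isSub of Cinf M for @Cinf_val R n M].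
HB.instance Definition _ := [Choice of Cinf M by <:].
HB.instance Definition _ :=
  GRing.SubChoice_isSubComPzRing.Build _ _ (Cinf M)
    (GRing.subringClosedP (smooth_pred M)).
HB.instance Definition _ := [SubZmodule_isSubLmodule of Cinf M by <:].

Lemma Cinf_smooth_in (f : Cinf M) : smooth_in setT f.
Proof. by case: f => f /= /asboolP. Qed.
End Cinf_algebra.

(* A local trivialization over the open set [tdom] of a family of vector
   spaces: a family of linear isomorphisms [E_x -> R^r]; values of [tmap],
   [tinv] off [tdom] are junk. *)
Record trivialization (R : realType) (M : topologicalType) (r : nat)
    (E : M -> lmodType R) := Trivialization {
  tdom : set M;
  tmap : forall x, {linear E x -> 'rV[R]_r};
  tinv : forall x, 'rV[R]_r -> E x;
  tdom_open : open tdom;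
  tmapK : forall x, tdom x -> cancel (tmap x) (tinv x);
  tinvK : forall x, tdom x -> cancel (tinv x) (tmap x)
}.

(* A smooth real vector bundle of rank [r], given by its fibers and an atlas of
   local trivializations with smooth transition matrices; the total space is the
   disjoint union of the fibers, with the smooth structure for which the
   trivializations are diffeomorphisms. *)
Record vector_bundle (R : realType) (n : nat) (M : manifold R n) (r : nat) :=
  VectorBundle {
  fiber :> M -> lmodType R;
  trivs : set (trivialization r fiber);
  trivs_cover : forall x, exists2 t, trivs t & tdom t x;
  trivs_smooth : forall s t, trivs s -> trivs t -> forall i j : 'I_r,
    smooth_in (tdom s `&` tdom t)
              (fun x => tmap t x (tinv s x (delta_mx 0 i)) 0 j)
}.

Section smooth_sections.
Context {R : realType} {n : nat} {M : manifold R n} {r : nat}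
  {E : vector_bundle M r}.
Implicit Types X Y : forall x, E x.

Definition smooth_section X : Prop :=
  forall t, trivs t -> forall j : 'I_r,
    smooth_in (tdom t) (fun x => tmap t x (X x) 0 j).

Lemma smooth_section0 : smooth_section (fun x => 0).
Proof.
move=> t _ j; apply: eq_smooth_in (smooth_in_cst 0 _); try exact: tdom_open.
by move=> x _; rewrite linear0 mxE.
Qed.

Lemma smooth_sectionD X Y :
  smooth_section X -> smooth_section Y -> smooth_section (fun x => X x + Y x).
Proof.
move=> sX sY t tt j.
apply: eq_smooth_in (smooth_inD _ (sX t tt j) (sY t tt j));
  try exact: tdom_open.
by move=> x _; rewrite linearD mxE.
Qed.

Lemma smooth_sectionM (f : Cinf M) X :
  smooth_section X -> smooth_section (fun x => f x *: X x).
Proof.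
move=> sX t tt j.
have sf : smooth_in (tdom t) f by apply: smooth_in_subset (Cinf_smooth_in f).
apply: eq_smooth_in (smooth_inM _ sf (sX t tt j)); try exact: tdom_open.
by move=> x _; rewrite linearZ mxE.
Qed.

Lemma smooth_sectionZ (a : R) X :
  smooth_section X -> smooth_section (fun x => a *: X x).
Proof.
move=> sX t tt j; have oD := @tdom_open _ _ _ _ t.
apply: eq_smooth_in (smooth_inM oD (smooth_in_cst a oD) (sX t tt j)) => //.
by move=> x _; rewrite linearZ mxE.
Qed.

End smooth_sections.

Record Sec (R : realType) (n : nat) (M : manifold R n) (r : nat)
    (E : vector_bundle M r) := MkSec {
  Sec_val :> forall x, E x;
  Sec_smooth : smooth_section Sec_val
}.

Section section_module.
Context {R : realType} {n : nat} {M : manifold R n} {r : nat}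
  {E : vector_bundle M r}.

Lemma SecP (X Y : Sec E) : (forall x, X x = Y x) -> X = Y.
Proof.
case: X Y => [X sX] [Y sY] /= XY.
have {}XY : X = Y by exact: functional_extensionality_dep.
by case: _ / XY sY => sY; congr MkSec; exact: Prop_irrelevance.
Qed.

Definition sec0 : Sec E := MkSec smooth_section0.
Definition secD (X Y : Sec E) : Sec E :=
  MkSec (smooth_sectionD (Sec_smooth X) (Sec_smooth Y)).
Definition secZ (a : R) (X : Sec E) : Sec E :=
  MkSec (smooth_sectionZ a (Sec_smooth X)).
Definition secM (f : Cinf M) (X : Sec E) : Sec E :=
  MkSec (smooth_sectionM f (Sec_smooth X)).

HB.instance Definition _ := gen_eqMixin (Sec E).
HB.instance Definition _ := gen_choiceMixin (Sec E).

Fact secDA : associative secD.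
Proof. by move=> X Y Z; apply: SecP => x /=; rewrite addrA. Qed.
Fact secDC : commutative secD.
Proof. by move=> X Y; apply: SecP => x /=; rewrite addrC. Qed.
Fact sec0D : left_id sec0 secD.
Proof. by move=> X; apply: SecP => x /=; rewrite add0r. Qed.
Fact secND : left_inverse sec0 (secZ (-1)) secD.
Proof. by move=> X; apply: SecP => x /=; rewrite scaleN1r addNr. Qed.

HB.instance Definition _ :=
  GRing.isZmodule.Build (Sec E) secDA secDC sec0D secND.

Fact secZA a b (X : Sec E) : secZ a (secZ b X) = secZ (a * b) X.
Proof. by apply: SecP => x /=; rewrite scalerA. Qed.
Fact sec1Z : left_id 1 secZ.
Proof. by move=> X; apply: SecP => x /=; rewrite scale1r. Qed.
Fact secZDr : right_distributive secZ +%R.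
Proof. by move=> a X Y; apply: SecP => x /=; rewrite scalerDr. Qed.
Fact secZDl (X : Sec E) : {morph secZ^~ X : a b / a + b}.
Proof. by move=> a b; apply: SecP => x /=; rewrite scalerDl. Qed.

HB.instance Definition _ :=
  GRing.Zmodule_isLmodule.Build R (Sec E) secZA sec1Z secZDr secZDl.

End section_module.

(* The canonical structure on [Sec E] is the real vector space one; the
   C^oo(M)-module structure is the separate operation [f *s X]. *)
Notation "f *s X" := (secM f X) (at level 40, left associativity) : ring_scope.

Definition Lie_bracket (R : realType) (V : lmodType R) (br : V -> V -> V) :
    Prop :=
  [/\ forall X, linear (br X),
      forall Y, linear (br^~ Y),
      forall X, br X X = 0 &
      forall X Y Z, br X (br Y Z) + br Y (br Z X) + br Z (br X Y) = 0].

Section algebroids.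
Context {R : realType} {n : nat} {M : manifold R n} {r : nat}
  {E : vector_bundle M r}.
Implicit Types (D : Sec E -> Sec E) (br : Sec E -> Sec E -> Sec E).

Definition quasi_derivation D : Prop :=
  linear D /\
  forall f : Cinf M, exists Df : Cinf M,
    forall X, D (f *s X) = f *s D X + Df *s X.

Definition Lie_QD_algebroid br : Prop :=
  [/\ Lie_bracket br,
      forall X, quasi_derivation (br X) &
      forall Y, quasi_derivation (br^~ Y)].

Definition derivation (d : Cinf M -> Cinf M) : Prop :=
  linear d /\
  forall f g, d (f * g) = d f * g + f * d g.

(* A C^oo(M)-linear map from [Sec E] to the derivations of C^oo(M). *)
Definition anchor (a : Sec E -> Cinf M -> Cinf M) : Prop :=
  (forall X, derivation (a X)) /\
  forall f X Y g, a (f *s X + Y) g = f * a X g + a Y g.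

Definition Lie_algebroid br : Prop :=
  Lie_bracket br /\
  exists a, [/\ anchor a,
    forall X Y f, br X (f *s Y) = f *s br X Y + a X f *s Y &
    forall X Y f, a (br X Y) f = a X (a Y f) - a Y (a X f)].

Definition supp (X : Sec E) : set M := closure [set x | X x != 0].

Definition local_Lie_algebra br : Prop :=
  Lie_bracket br /\ forall X Y, supp (br X Y) `<=` supp X `&` supp Y.

End algebroids.

(* Main.v *)
Require Import Defs.
From mathcomp Require Import all_boot all_order all_algebra.
From mathcomp Require Import all_classical all_reals all_analysis.
From HB Require Import structures.
From mathcomp Require Import ring lra zify.

(** Sections with prescribed values and supports are produced by smooth bump
    functions. If the rank exceeds 1, expanding [[f X, g Y]] in two ways gives
    [(a (f X) g - f a(X) g) Y = (g a(Y) f - a (g Y) f) X], and choosing [Y]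
    independent of [X] at a given point forces the anchor to be tensorial.

    In rank 1 the point is that a local Lie bracket is of first order in each
    argument. A Peetre type argument shows that the order is finite near every
    point [p]: otherwise there are points [q_k -> p] and [X_k, f_k, Y_k] with
    [f_k (q_k) = 0] and [[X_k, f_k ^+ k.+1 Y_k] (q_k) <> 0]; multiples of the
    [X_k] and of the [f_k ^+ k.+1 Y_k], cut off in small disjoint neighborhoods
    of the [q_k], glue to smooth sections whose bracket is unbounded near [p].
    A bracket of finite order [k >= 2] is of order [k - 1] (Kirillov,
    Grabowski): the Jacobi identity makes the principal symbols of [[X, -]] and
    [[Y, -]] Poisson commute, since the bracket of operators of order [k] has
    order [2 k - 1 > k]; this is impossible unless these symbols vanish. *)

Set Implicit Arguments.
Unset Strict Implicit.
Unset Printing Implicit Defensive.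

Import Order.TTheory GRing.Theory Num.Theory.
Import numFieldNormedType.Exports.

Local Open Scope classical_set_scope.
Local Open Scope ring_scope.

(** * Lie brackets of finite order on a commutative ring *)

(** That the symbols vanish is decided by counting orders in the other argument. By antisymmetry the
    bracket has finite order in [x] too, hence so has the symbol of [[x, -]], seen as an operator in
    [x]; let this order be at most [m]. By the Poisson relation, applying to that operator the first
    order operator given by the symbol of [[y, -]] yields again an operator of order at most [m] in
    [x]. Since such a composition should raise the order by one, a product of two top symbols is
    zero; so [m] can be lowered, until nothing is left.

    Orders are measured by iterated commutators with multiplication by a single [f]; mixed
    commutators are recovered by replacing [f] with [f + m h] and comparing powers of the integer
    [m].

    In the Peetre argument the factors that make the bracket large at [q_k] may be huge. They do no
    harm because [f_k ^+ k.+1] vanishes to high order at [q_k]: cut off where [f_k] is small enough,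
    its multiples have derivatives up to order [k] as small as desired. *)

Lemma iter_addC_binomial (W : zmodType) (L K : W -> W) :
  {morph L : u v / u + v} -> {morph K : u v / u + v} ->
  (forall w, L (K w) = K (L w)) ->
  forall k w, iter k (fun v => L v + K v) w =
    \sum_(i < k.+1) iter (k - i) L (iter i K w) *+ 'C(k, i).
Proof.
move=> LD KD LK k w.
have iterK (N : W -> W) (ND : {morph N : u v / u + v}) :
    exists2 N' : {additive W -> W}, N' =1 N & True.
  have NB : zmod_morphism N.
    move=> u v; apply: (addIr (N v)); rewrite -ND !subrK //.
  pose H := GRing.isZmodMorphism.Build W W N NB.
  pose N' : {additive W -> W} := HB.pack N H.
  by exists N'.
have [L' L'E _] := iterK L LD; have [K' K'E _] := iterK K KD.
elim: k => [|k IH] /=; first by rewrite big_ord1 /= bin0 mulr1n.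
rewrite IH.
have -> : L (\sum_(i < k.+1) iter (k - i) L (iter i K w) *+ 'C(k, i)) =
   \sum_(i < k.+1) iter (k.+1 - i) L (iter i K w) *+ 'C(k, i).
  rewrite -L'E raddf_sum; apply: eq_bigr => i _.
  by rewrite raddfMn L'E subSn// -ltnS.
have -> : K (\sum_(i < k.+1) iter (k - i) L (iter i K w) *+ 'C(k, i)) =
   \sum_(i < k.+1) iter (k - i) L (iter i.+1 K w) *+ 'C(k, i).
  rewrite -K'E raddf_sum; apply: eq_bigr => i _.
  rewrite raddfMn K'E /=; congr (_ *+ _).
  by elim: (k - i)%N => //= j <-; rewrite LK.
rewrite [in RHS]big_ord_recl /= [in LHS]big_ord_recl /= -addrA.
rewrite !bin0; congr (_ + _).
rewrite [in RHS]big_ord_recr /= !subnn /= binn [X in _ + X = _]big_ord_recr /=.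
rewrite subnn binn addrA; congr (_ + _); rewrite -big_split /=.
apply: eq_bigr => i _.
by rewrite /bump leq0n /= add1n subSS binS mulrnDr.
Qed.

(** * Polynomials vanishing at all natural numbers *)

Section polynomial_values.
Context {R : numDomainType}.
Implicit Types p q : {poly R}.

Lemma poly_nat_zero p : (forall m : nat, p.[m%:R] = 0) -> p = 0.
Proof.
move=> p0; apply: contraTeq isT => pn0.
have := max_poly_roots pn0 (_ : all (root p) [seq (i%:R : R) | i <- iota 0 (size p)])
  (_ : uniq _).
rewrite size_map size_iota ltnn; apply.
  by apply/allP => _ /mapP[i _ ->]; apply/rootP.
rewrite map_inj_uniq ?iota_uniq// => i j /eqP; rewrite eqr_nat => /eqP //.
Qed.

Lemma polarize_coef k (q : nat -> R) :
  (forall m : nat, \sum_(i < k.+1) m%:R ^+ i * q i = 0) ->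
  forall i, (i <= k)%N -> q i = 0.
Proof.
move=> q0 i ik.
have p0 : \poly_(j < k.+1) q j = 0.
  apply: poly_nat_zero => m; rewrite horner_poly -[RHS](q0 m).
  by apply: eq_bigr => j _; rewrite mulrC.
by move/polyP/(_ i): p0; rewrite coef_poly ltnS ik coef0.
Qed.

(** Polynomials over a domain form a domain, and the affine factor is nonzero because its slope [b]
    is. *)
Lemma linear_factor_coef (a b : R) k (q : nat -> R) : b != 0 ->
  (forall m : nat, (a + m%:R * b) * (\sum_(i < k.+1) m%:R ^+ i * q i) = 0) ->
  q 0 = 0.
Proof.
move=> b0 q0.
have : (a%:P + b *: 'X) * \poly_(j < k.+1) q j = 0.
  apply: poly_nat_zero => m; rewrite hornerM horner_poly -[RHS](q0 m).
  rewrite !hornerE mulrC [b * _]mulrC [LHS]mulrC; congr (_ * _).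
  by apply: eq_bigr => j _; rewrite mulrC.
move/eqP; rewrite mulf_eq0 => /orP[/eqP/polyP/(_ 1)|/eqP/polyP/(_ 0)].
  by rewrite coefD coefC coefZ coefX coef0 /= mulr1 add0r => /eqP; rewrite (negbTE b0).
by rewrite coef_poly coef0.
Qed.

End polynomial_values.

(** * Iterated commutators with multiplications *)

Section commutators.
Context {A : comPzRingType}.
Implicit Types (f g h y : A) (D : A -> A).

(** The commutator of [D] with multiplication by [f]. Order at most [k], in the sense of
    Grothendieck, is the vanishing of [iter k.+1 (delta f) D] for all [f]. *)
Definition delta f D : A -> A := fun y => D (f * y) - f * D y.

(** Additivity is enough, since polarization uses integer multiples only; the ring [A] carries no
    scalars. *)
Definition additive_fun D := {morph D : u v / u + v}.

Lemma additive_fun0 D : additive_fun D -> D 0 = 0.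
Proof. by move=> DD; apply: (addrI (D 0)); rewrite -DD !addr0. Qed.

Lemma additive_funN D y : additive_fun D -> D (- y) = - D y.
Proof. by move=> DD; apply: (addrI (D y)); rewrite -DD !subrr additive_fun0. Qed.

Lemma additive_funMn D y m : additive_fun D -> D (y *+ m) = D y *+ m.
Proof. by move=> DD; elim: m => [|m IH]; rewrite ?additive_fun0// !mulrS DD IH. Qed.

Lemma delta_morphD f : {morph delta f : D D' / D + D'}.
Proof. by move=> D D'; apply/funext => y; rewrite /delta !addrfctE; ring. Qed.

Lemma deltaC f g D : delta f (delta g D) = delta g (delta f D).
Proof. by apply/funext => y; rewrite /delta (mulrCA g f); ring. Qed.

Lemma delta_additive f D : additive_fun D -> additive_fun (delta f D).
Proof. by move=> DD u v; rewrite /delta mulrDr !DD; ring. Qed.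

Lemma iter_delta_additive k f D : additive_fun D -> additive_fun (iter k (delta f) D).
Proof. by move=> DD; elim: k => //= k; exact: delta_additive. Qed.

Lemma iter_delta_morphD k f : {morph iter k (delta f) : D D' / D + D'}.
Proof. by move=> D D'; elim: k => //= k ->; rewrite delta_morphD. Qed.

Lemma iter_delta0 k f : iter k (delta f) 0 = 0.
Proof. by apply: (addrI (iter k (delta f) 0)); rewrite -iter_delta_morphD !addr0. Qed.

Lemma iter_deltaN k f D : iter k (delta f) (- D) = - iter k (delta f) D.
Proof.
by apply: (addrI (iter k (delta f) D)); rewrite -iter_delta_morphD !subrr iter_delta0.
Qed.

Lemma iter_deltaMn k f D m : iter k (delta f) (D *+ m) = iter k (delta f) D *+ m.
Proof.
by elim: m => [|m IH]; rewrite ?mulr0n ?iter_delta0// !mulrS iter_delta_morphD IH.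
Qed.

Lemma iter_delta_sum k f n (F : 'I_n -> A -> A) :
  iter k (delta f) (\sum_i F i) = \sum_i iter k (delta f) (F i).
Proof.
apply: (big_morph _ (iter_delta_morphD k f)); exact: iter_delta0.
Qed.

Lemma iter_delta_deltaC k f g D :
  iter k (delta f) (delta g D) = delta g (iter k (delta f) D).
Proof. by elim: k => //= k ->; rewrite deltaC. Qed.

Lemma deltaDl f g D : additive_fun D -> delta (f + g) D = delta f D + delta g D.
Proof.
by move=> DD; apply/funext => y; rewrite /delta addrfctE mulrDl DD; ring.
Qed.

Lemma deltaMnl f m D : additive_fun D -> delta (f *+ m) D = delta f D *+ m.
Proof.
move=> DD; apply/funext => y; rewrite /delta natmulfctE mulrnAl additive_funMn//.
by rewrite mulrnAl mulrnBl.
Qed.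

(** On additive operators [delta (f + h *+ m)] is the sum of the commuting operators [delta f] and
    [m] times [delta h], so the binomial formula applies. *)
Lemma iter_delta_line k f h m D : additive_fun D ->
  iter k (delta (f + h *+ m)) D =
  \sum_(i < k.+1) iter (k - i) (delta f) (iter i (delta h) D) *+ (m ^ i * 'C(k, i)).
Proof.
move=> DD.
pose K D := delta h D *+ m.
have iterK i : iter i K D = iter i (delta h) D *+ (m ^ i).
  elim: i => [|i IH]; first by rewrite expn0 mulr1n.
  have -> : iter i.+1 K D = K (iter i K D) by [].
  rewrite IH /K -[delta h (_ *+ _)]/(iter 1 (delta h) _) iter_deltaMn /=.
  by rewrite -mulrnA expnSr.
transitivity (iter k (fun D => delta f D + K D) D).
  elim: k => //= k IH; rewrite -IH; set D' := iter _ _ _.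
  have DD' : additive_fun D' by exact: iter_delta_additive.
  by rewrite deltaDl// deltaMnl.
rewrite iter_addC_binomial; first last.
- by move=> w; rewrite /K -[delta f (_ *+ _)]/(iter 1 (delta f) _) iter_deltaMn /= deltaC.
- by move=> u v; rewrite /K delta_morphD mulrnDl.
- exact: delta_morphD.
by apply: eq_bigr => i _; rewrite iterK iter_deltaMn -mulrnA.
Qed.

Lemma iter_delta_comp N f D D' y : additive_fun D ->
  iter N (delta f) (D \o D') y =
  \sum_(i < N.+1)
    iter (N - i) (delta f) D (iter i (delta f) D' y) *+ 'C(N, i).
Proof.
move=> DD.
(* The slot [u] between the two operators separates their commutators: [L] acts as [delta f] on [D],
   [K] as [delta f] on [D'], and [L + K] is the commutator in the last variable. The composite is
   the case [u = 1]. *)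
pose L (t : A -> A -> A) : A -> A -> A := fun u y => t (f * u) y - f * t u y.
pose K (t : A -> A -> A) : A -> A -> A := fun u y => t u (f * y) - t (f * u) y.
pose t D D' : A -> A -> A := fun u y => D (u * D' y).
have Lt D1 D2 : L (t D1 D2) = t (delta f D1) D2.
  by apply/funext => u; apply/funext => v; rewrite /L /t /delta !mulrA.
have Kt D1 D2 : additive_fun D1 -> K (t D1 D2) = t D1 (delta f D2).
  move=> D1D; apply/funext => u; apply/funext => v; rewrite /K /t /delta.
  by rewrite mulrBr D1D (additive_funN _ D1D); congr (_ - D1 _); rewrite mulrCA mulrA.
have LKt D1 D2 v : iter N (delta f) (fun v => t D1 D2 1 v) v =
    iter N (fun t => L t + K t) (t D1 D2) 1 v.
  elim: N v => //= n IH v; rewrite /delta !IH !addrfctE /L /K /=; ring.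
transitivity (iter N (fun t => L t + K t) (t D D') 1 y).
  rewrite -LKt; congr (iter N _ _ _); apply/funext => v.
  by rewrite /t /= mul1r.
rewrite iter_addC_binomial; first last.
- move=> w; apply/funext => u; apply/funext => v; rewrite /K /L.
  by rewrite /=; ring.
- by move=> u v; apply/funext => a; apply/funext => b; rewrite /K !addrfctE /=; ring.
- by move=> u v; apply/funext => a; apply/funext => b; rewrite /L !addrfctE /=; ring.
have iK i : iter i K (t D D') = t D (iter i (delta f) D').
  by elim: i => //= i ->; rewrite Kt.
have iL i D1 D2 : iter i L (t D1 D2) = t (iter i (delta f) D1) D2.
  by elim: i => //= i ->; rewrite Lt.
rewrite !fct_sumE; apply: eq_bigr => i _.
by rewrite iK iL !natmulfctE /t mul1r.
Qed.

End commutators.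

(** * Lowering the order of a Lie bracket *)

Section order_reduction.
Context {R : numDomainType} {A : comPzRingType} {S : Type}.
(** Rings of functions have zero divisors. The evaluations detect zero and land in a domain, where
    the polynomial arguments apply. *)
Variable ev : S -> {rmorphism A -> R}.
Hypothesis ev_inj : forall a, (forall s, ev s a = 0) -> a = 0.

Lemma mulrSn_eq0 (a : A) m : a *+ m.+1 = 0 -> a = 0.
Proof.
move=> am; apply: ev_inj => s; apply/eqP; move/(congr1 (ev s)): am.
by rewrite rmorphMn rmorph0 => /eqP; rewrite mulrn_eq0.
Qed.

(** Extracts the coefficient of [m] from a polynomial in [m]; its binomial factor [k.+1] is
    cancelled by [mulrSn_eq0]. *)
Lemma polarize_line k (G : nat -> A) :
  (forall m, \sum_(i < k.+2) G i *+ (m ^ i * 'C(k.+1, i)) = 0) -> G 1%N = 0.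
Proof.
move=> G0; apply: (@mulrSn_eq0 _ k); apply: ev_inj => s.
rewrite rmorphMn -(bin1 k.+1).
apply: (@polarize_coef _ k.+1 (fun i => ev s (G i) *+ 'C(k.+1, i)) _ 1) => // m.
rewrite -[RHS](rmorph0 (ev s)) -(G0 m) rmorph_sum; apply: eq_bigr => i _.
by rewrite rmorphMn mulnC mulrnA -[in RHS](mulr_natl _ (m ^ i)) natrX.
Qed.

(** Replace [f] by [f + h *+ m] and take the part linear in [m]. *)
Lemma delta_polarize k (D : A -> A) :
  additive_fun D -> (forall f, iter k.+1 (delta f) D = 0) ->
  forall f h, delta h (iter k (delta f) D) = 0.
Proof.
move=> DD D0 f h; apply/funext => y.
rewrite -iter_delta_deltaC.
rewrite -[k in iter k]subn0 -subSS.
apply: (@polarize_line k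
  (fun i => iter (k.+1 - i) (delta f) (iter i (delta h) D) y)) => m.
transitivity (iter k.+1 (delta (f + h *+ m)) D y); last by rewrite D0.
by rewrite iter_delta_line// fct_sumE; apply: eq_bigr => i _; rewrite natmulfctE.
Qed.

Lemma delta_mul (D : A -> A) : (forall g, delta g D = 0) -> forall y, D y = y * D 1.
Proof.
move=> D0 y; move/(congr1 (fun F => F 1)): (D0 y); rewrite /delta mulr1.
by move/eqP; rewrite subr_eq0 => /eqP.
Qed.

(** In the Leibniz formula at most one commutator may fall on [F] and at most [m] on [Phi]. A single
    term survives, with coefficient ['C(m.+1, m)]. *)
Lemma iter_delta_comp1 m g (F Phi : A -> A) : additive_fun F -> additive_fun Phi ->
  delta g (delta g F) = 0 -> iter m.+1 (delta g) Phi = 0 ->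
  forall y, iter m.+1 (delta g) (F \o Phi) y =
            delta g F (iter m (delta g) Phi y) *+ m.+1.
Proof.
move=> FD PD F0 P0 y; rewrite iter_delta_comp// !big_ord_recr /=.
have P0' : delta g (iter m (delta g) Phi) = 0 := P0.
rewrite subnn subSnn /= P0'.
rewrite -[(0 : A -> A) y]/0 (additive_fun0 FD) mul0rn addr0.
rewrite -[m.+1 in RHS]binSn big1 ?add0r// => i _.
have -> : (m.+1 - i = (m - i.+1).+2)%N.
  by rewrite -subSn// subSS subSn// ltnW.
by rewrite 2!iterSr F0 iter_delta0 mul0rn.
Qed.

Variable B : A -> A -> A.
Hypothesis BDl : forall y, additive_fun (B^~ y).
Hypothesis BDr : forall x, additive_fun (B x).
Hypothesis Banti : forall x y, B x y = - B y x.
Hypothesis Bjac : forall x y z, B x (B y z) + B y (B z x) + B z (B x y) = 0.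

Lemma B_comm x y : (B x \o B y) - (B y \o B x) = B (B x y).
Proof.
apply/funext => z; rewrite addrfctE opprfctE /=.
rewrite [B (B x y) z]Banti; apply/eqP; rewrite -addr_eq0.
rewrite -[X in _ == X](Bjac x y z) [B z x]Banti (additive_funN _ (BDr _)).
by apply/eqP; ring.
Qed.

Section descent.
Variable j : nat.
Notation k := j.+2.
Hypothesis Bk : forall f x, iter k.+1 (delta f) (B x) = 0.
Variable f : A.

(** Up to the factor [k!], [Phi x] is the principal symbol of [B x] at the differential of [f], and
    [delta h (P x) 1] is the same symbol polarized, with one slot taken by the differential of
    [h]. *)
Let P x := iter k.-1 (delta f) (B x).
Let Phi x := iter k (delta f) (B x) 1.

Let PD x : additive_fun (P x). Proof. exact: iter_delta_additive. Qed.

Let deltak h x : delta h (iter k (delta f) (B x)) = 0.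
Proof. exact: delta_polarize. Qed.

Let PhiE x y : iter k (delta f) (B x) y = y * Phi x.
Proof. by apply: delta_mul => h; exact: deltak. Qed.

Let deltaP h h' x : delta h (delta h' (P x)) = 0.
Proof.
rewrite -iter_delta_deltaC; apply: (@delta_polarize j.+1 (delta h' (B x))).
  exact: delta_additive.
by move=> g; rewrite iter_delta_deltaC; exact: delta_polarize.
Qed.

(* The Poisson bracket of the principal symbols of [B x] and [B y] vanishes:
   it is the part of order [2 k - 1 > k] of [B (B x y)]. *)
Lemma symbol_comm x y : delta (Phi y) (P x) 1 = delta (Phi x) (P y) 1.
Proof.
(* At most [k] commutators may fall on either factor, so out of [2 k - 1] only the splittings
   [(k, k - 1)] and [(k - 1, k)] survive. As [k >= 2], [N] exceeds [k] and kills [B (B x y)]. *)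
pose N := (k + k.-1)%N.
have B0 u i : (k < i)%N -> iter i (delta f) (B u) = 0.
  by move=> /subnK <-; rewrite iterD Bk iter_delta0.
have comp u v : iter N (delta f) (B u \o B v) 1 =
    (Phi u * P v 1 + P u (Phi v)) *+ 'C(N, k).
  rewrite iter_delta_comp//.
  have kN : (k < N.+1)%N by rewrite ltnS leq_addr.
  have k1N : (k.-1 < N.+1)%N by rewrite ltnS leq_addl.
  rewrite (bigD1 (Ordinal kN))//= (bigD1 (Ordinal k1N)) /=; last first.
    by rewrite -val_eqE /= neq_ltn leqnn.
  rewrite big1 ?addr0 => [|i /andP[/eqP/val_eqP /= ik /eqP/val_eqP /= ik1]].
    rewrite /N {1}addnC addnK {1}addnK -[j.+1]/(k.-1).
    rewrite -[in X in _ + X](bin_sub (leq_addl _ _)) addnK.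
    by rewrite PhiE -mulrnDl mulrC [X in X *+ _ = _]addrC mulrC.
  have [ki|ik'] := ltnP k i.
    rewrite (B0 v)//= -[X in X *+ _]/(_ 0) additive_fun0 ?mul0rn//.
    exact: iter_delta_additive.
  rewrite B0 ?mul0rn// /N /=.
  by move: (nat_of_ord i) ik ik1 ik' => {}i /eqP ik /eqP ik1 ik'; lia.
have : (Phi x * P y 1 + P x (Phi y)) *+ 'C(N, k) -
       (Phi y * P x 1 + P y (Phi x)) *+ 'C(N, k) = 0.
  rewrite -!comp -[RHS]/((0 : A -> A) 1) -(B0 (B x y) N); last first.
    by rewrite /N -addn1 leq_add2l.
  by rewrite -B_comm iter_delta_morphD iter_deltaN.
rewrite -mulrnBl.
have := bin_gt0 N k; rewrite leq_addr; case: 'C(N, k) => // c _ /mulrSn_eq0 E.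
by apply/eqP; rewrite /delta -subr_eq0 !mulr1; apply/eqP; rewrite -[RHS]E; ring.
Qed.

Let PhiD : additive_fun Phi.
Proof.
move=> u v; rewrite /Phi (_ : B (u + v) = B u + B v); last first.
  by apply/funext => y; rewrite addrfctE BDl.
by rewrite iter_delta_morphD.
Qed.

(** By [symbol_comm], [F \o Phi] is the map [x |-> delta h (P x) 1] with [h = Phi y], hence of order
    at most [m] in [x], as is [Phi] (the case [h = f]). But its commutator of length [m.+1] is, up
    to an integer factor, the product in the conclusion. *)
Lemma symbol_product m :
  (forall g h, iter m.+1 (delta g) (fun x => delta h (P x) 1) = 0) ->
  forall g x y, delta g (P y) 1 * iter m (delta g) Phi x = 0.
Proof.
move=> Pm g x y.
pose F a := delta a (P y) 1.
have FE a : F a = P y a - a * P y 1 by rewrite /F /delta mulr1.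
have FD : additive_fun F by move=> u v; rewrite !FE PD; ring.
have gF : delta g F = delta g (P y).
  by apply/funext => a; rewrite /delta !FE; ring.
have ggF : delta g (delta g F) = 0 by rewrite gF deltaP.
have Phi0 : iter m.+1 (delta g) Phi = 0 by exact: Pm.
have := iter_delta_comp1 FD PhiD ggF Phi0 x.
have -> : F \o Phi = (fun x => delta (Phi y) (P x) 1).
  by apply/funext => x'; rewrite /= symbol_comm.
rewrite Pm => /esym /mulrSn_eq0; rewrite gF (delta_mul (fun h => deltaP h g y)).
by rewrite mulrC.
Qed.

(* Replacing [g] by [g + m f] in [symbol_product] turns its first factor into
   an affine function of [m] with slope [Phi y]. *)
Lemma symbol_order m :
  (forall g h, iter m.+1 (delta g) (fun x => delta h (P x) 1) = 0) ->
  forall g, iter m (delta g) Phi = 0.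
Proof.
move=> Pm g; apply/funext => x; apply: ev_inj => s.
(* At a point where all symbols vanish, so do the commutators of [Phi], which are combinations of
   symbols. Elsewhere some slope [Phi y] is nonzero. *)
have [y0|/existsNP[y /eqP y0]] := pselect (forall y, ev s (Phi y) = 0).
  by elim: m x {Pm} => //= m IH x; rewrite /delta rmorphB rmorphM !IH mulr0 subrr.
have := @linear_factor_coef _ (ev s (delta g (P y) 1)) (ev s (Phi y)) m
  (fun i => ev s (iter (m - i) (delta g) (iter i (delta f) Phi) x) *+ 'C(m, i)) y0.
rewrite subn0 bin0 mulr1n; apply => n.
rewrite -[RHS](rmorph0 (ev s)) -(symbol_product Pm (g + f *+ n) x y) rmorphM.
congr (_ * _).
  rewrite deltaDl// deltaMnl// addrfctE natmulfctE [RHS]rmorphD rmorphMn.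
  by rewrite mulr_natl.
rewrite iter_delta_line// fct_sumE rmorph_sum; apply: eq_bigr => i _.
by rewrite natmulfctE rmorphMn mulnC mulrnA -natrX mulr_natl.
Qed.

End descent.

(** Descending induction on the order in [x] of the polarized symbol [delta h (P x) 1], from a bound
    given by antisymmetry down to the vanishing of the symbol itself. *)
Lemma order_step j : (forall f x, iter j.+3 (delta f) (B x) = 0) ->
  forall f x, iter j.+2 (delta f) (B x) = 0.
Proof.
move=> Bk.
(* [Psi] acts in the second argument and is linear over multiplication of values by [A], so it can
   be exchanged with commutators in the first argument. *)
have BE g N (Psi : (A -> A) -> A) :
    {morph Psi : D D' / D + D'} ->
    (forall a D, Psi (fun y => a * D y) = a * Psi D) ->
    forall x, iter N (delta g) (fun x => Psi (B x)) x =
      Psi (fun y => iter N (delta g) (B^~ y) x).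
  move=> PsiD PsiM; elim: N => //= N IH x.
  rewrite /delta !IH -PsiM.
  have -> : (fun y => iter N (delta g) (B^~ y) (g * x) -
      g * iter N (delta g) (B^~ y) x) =
    (fun y => iter N (delta g) (B^~ y) (g * x)) +
    (fun y => (- g) * iter N (delta g) (B^~ y) x).
    by apply/funext => y; rewrite addrfctE mulNr.
  by rewrite PsiD !PsiM mulNr.
(* The start of the descent: [B^~ y = - B y] has the same order in the first argument. *)
have top f g h : iter j.+3 (delta g)
    (fun x => delta h (iter j.+1 (delta f) (B x)) 1) = 0.
  apply/funext => x.
  pose Psi D := delta h (iter j.+1 (delta f) D) 1.
  have PsiM a D : Psi (fun y => a * D y) = a * Psi D.
    rewrite /Psi; set n := j.+1.
    have -> : iter n (delta f) (fun y => a * D y) = fun y => a * iter n (delta f) D y.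
      elim: n => //= n ->; apply/funext => y; rewrite /delta; ring.
    by rewrite /delta; ring.
  have PsiD : {morph Psi : D D' / D + D'}.
    by move=> D D'; rewrite /Psi iter_delta_morphD delta_morphD.
  rewrite (BE g _ Psi PsiD PsiM).
  have -> : (fun y => iter j.+3 (delta g) (B^~ y) x) = fun y => 0 * (0 : A -> A) y.
    apply/funext => y; rewrite mul0r.
    have -> : B^~ y = - B y by apply/funext => z; rewrite Banti.
    by rewrite iter_deltaN Bk oppr0.
  by rewrite PsiM mul0r.
(* [symbol_order] lowers the order for [h = f] only; its linear part under [f + h *+ n] gives every
   [h]. *)
have step m : (forall f g h, iter m.+1 (delta g)
      (fun x => delta h (iter j.+1 (delta f) (B x)) 1) = 0) ->
    forall f g h, iter m (delta g)
      (fun x => delta h (iter j.+1 (delta f) (B x)) 1) = 0.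
  move=> Pm f g h; apply/funext => x.
  have -> : (fun x => delta h (iter j.+1 (delta f) (B x)) 1) =
     (fun x => iter (j.+2 - 1) (delta f) (iter 1 (delta h) (B x)) 1).
    by apply/funext => z; rewrite subn1 iter_delta_deltaC.
  apply: (@polarize_line j.+1 (fun i => iter m (delta g)
    (fun x => iter (j.+2 - i) (delta f) (iter i (delta h) (B x)) 1) x)) => n.
  have := congr1 (fun F => F x) (symbol_order Bk (Pm (f + h *+ n)) g).
  have -> : (fun x => iter j.+2 (delta (f + h *+ n)) (B x) 1) =
    \sum_(i < j.+3) (fun x => iter (j.+2 - i) (delta f) (iter i (delta h) (B x)) 1)
       *+ (n ^ i * 'C(j.+2, i)).
    apply/funext => z; rewrite iter_delta_line// !fct_sumE; apply: eq_bigr => i _.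
    by rewrite !natmulfctE.
  rewrite iter_delta_sum fct_sumE => E; rewrite -[RHS]/((0 : A -> A) x) -E.
  apply: eq_bigr => i _.
  by rewrite iter_deltaMn natmulfctE.
have P0 m : (m <= j.+3)%N -> forall f g h, iter m (delta g)
      (fun x => delta h (iter j.+1 (delta f) (B x)) 1) = 0.
  move=> mj; rewrite -(subKn mj); elim: (j.+3 - m)%N => [|i IH].
    by rewrite subn0.
  case: (leqP j.+3 i) => ij; last by apply: step; rewrite subnSK.
  by move: IH; rewrite (eqP ij) (eqP (leqW ij)).
move=> f x; apply/funext => y.
rewrite (delta_mul (fun g => delta_polarize (BDr x) (Bk^~ x) f g)).
(* For [m = 0] no commutator is left and [g] is arbitrary; [h = f] gives the full symbol. *)
have := congr1 (fun F => F x) (P0 0%N isT f 0 f) => /= ->.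
by rewrite mulr0.
Qed.

Theorem order_le1 k : (forall f x, iter k.+2 (delta f) (B x) = 0) ->
  forall f x, iter 2 (delta f) (B x) = 0.
Proof. by elim: k => // k IH Bk; apply: IH; exact: order_step. Qed.

End order_reduction.

(** * Calculus on R^n *)

Section chain_rule.
Context {R : realType}.

Lemma is_derive_line (V W : normedModType R) (g : V -> W) (p v : V) (t : R) :
  derivable g (t *: v + p) v ->
  is_derive t 1 (fun s => g (s *: v + p)) ('D_v g (t *: v + p)).
Proof.
move=> dg.
have E : (fun h : R => h^-1 *: (((fun s => g (s *: v + p)) \o shift t) (h *: 1)
      - g (t *: v + p))) =
    (fun h => h^-1 *: ((g \o shift (t *: v + p)) (h *: v) - g (t *: v + p))).
  apply/funext => h /=; congr (_ *: (g _ - _)).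
  by rewrite [h *: 1]mulr1 scalerDl addrA.
by split; rewrite /derivable /derive E.
Qed.

Lemma increment_le (n : nat) (g : 'rV[R]_n -> R) (j : 'I_n) (q : 'rV[R]_n)
    (a d e : R) :
  (forall s : R, `|s| <= `|a| -> derivable g (s *: delta_mx 0 j + q) (delta_mx 0 j)) ->
  (forall s : R, `|s| <= `|a| ->
     `|'D_(delta_mx 0 j) g (s *: delta_mx 0 j + q) - d| <= e) ->
  `|g (a *: delta_mx 0 j + q) - g q - a * d| <= e * `|a|.
Proof.
move=> dg de; set v := delta_mx 0 j in dg de *.
pose F (s : R) := g (s *: v + q).
have dF (s : R) : `|s| <= `|a| -> is_derive s 1 F ('D_v g (s *: v + q)).
  by move=> sa; apply: is_derive_line; exact: dg.
have cF (s : R) : `|s| <= `|a| -> {for s, continuous F}.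
  by move=> /dF [dFs _]; exact/differentiable_continuous/derivable1_diffP.
have F0 : F 0 = g q by rewrite /F scale0r add0r.
rewrite -F0 -/(F a).
have [a0|a0] := leP 0 a.
- have [||c cab ->] := @MVT_segment R F (fun s => 'D_v g (s *: v + q)) 0 a a0.
  + move=> x; rewrite in_itv /= => /andP[x0 xa]; apply: dF.
    by rewrite !ger0_norm //; exact: ltW.
  + apply: continuous_in_subspaceT => x; rewrite inE /= in_itv /= => /andP[x0 xa].
    by apply: cF; rewrite !ger0_norm.
  rewrite subr0 mulrC -mulrBr normrM mulrC ler_wpM2r// de//.
  by move: cab; rewrite in_itv /= => /andP[x0 xa]; rewrite !ger0_norm.
- have [||c cab E] := @MVT_segment R F (fun s => 'D_v g (s *: v + q)) a 0 (ltW a0).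
  + move=> x; rewrite in_itv /= => /andP[x0 xa]; apply: dF.
    by rewrite !ler0_norm ?lerN2 //; exact: ltW.
  + apply: continuous_in_subspaceT => x; rewrite inE /= in_itv /= => /andP[x0 xa].
    by apply: cF; rewrite !ler0_norm ?lerN2 //; exact: ltW.
  rewrite -[F a - F 0]opprB E sub0r mulrN opprK mulrC -mulrBr normrM mulrC.
  rewrite ler_wpM2r// de//; move: cab; rewrite in_itv /= => /andP[x0 xa].
  by rewrite !ler0_norm ?lerN2 //; exact: ltW.
Qed.

Lemma rV_norm_le n (x : 'rV[R]_n) (c : R) : 0 <= c ->
  (forall j, `|x 0 j| <= c) -> `|x| <= c.
Proof.
move=> c0 xc; rewrite [leLHS]/Num.Def.normr /= mx_normrE.
by apply/bigmax_leP; split => // -[i j] _ /=; rewrite ord1.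
Qed.

Lemma rV_coord_le n (x : 'rV[R]_n) j : `|x 0 j| <= `|x|.
Proof.
rewrite [leRHS]/Num.Def.normr /= mx_normrE.
by apply/bigmax_geP; right => /=; exists (0, j).
Qed.

Lemma mean_value_le n (g : 'rV[R]_n -> R) (y h : 'rV[R]_n) (e : R) :
  (forall z, `|z - y| <= `|h| -> forall j, derivable g z (delta_mx 0 j)) ->
  (forall z, `|z - y| <= `|h| -> forall j,
     `|'D_(delta_mx 0 j) g z - 'D_(delta_mx 0 j) g y| <= e) ->
  `|g (h + y) - g y - \sum_j h 0 j * 'D_(delta_mx 0 j) g y| <=
     e * \sum_j `|h 0 j|.
Proof.
move=> dg de.
(* The path from [y] to [h + y] that changes one coordinate at a time: [w k] carries the first [k]
   coordinates of [h]. *)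
pose w k : 'rV[R]_n := \row_j (h 0 j *+ (j < k)%N).
have wS (k : 'I_n) : w k.+1 = h 0 k *: delta_mx 0 k + w k.
  apply/rowP => j; rewrite !mxE ltnS leq_eqVlt -val_eqE /=.
  have -> : (nat_of_ord j == k) = (j == k) by [].
  case: (eqVneq j k) => [->|_]; rewrite ?ltnn ?mulr1 ?addr0//.
  by rewrite mulr0 add0r.
have wn : w n = h by apply/rowP => j; rewrite mxE ltn_ord.
have w0 : w 0%N = 0 by apply/rowP => j; rewrite !mxE.
have -> : g (h + y) - g y = \sum_(k < n) (g (w k.+1 + y) - g (w k + y)).
  rewrite -(big_mkord xpredT (fun k => g (w k.+1 + y) - g (w k + y))).
  by rewrite telescope_sumr// wn w0 add0r.
rewrite -sumrB (le_trans (ler_norm_sum _ _ _))// mulr_sumr ler_sum// => k _.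
have zle s : `|s| <= `|h 0 k| ->
    `|s *: delta_mx 0 k + (w k + y) - y| <= `|h|.
  move=> sk; rewrite addrA addrK; apply: rV_norm_le => // j.
  rewrite !mxE eqxx andTb; case: (eqVneq j k) => [->|jk].
    by rewrite ltnn mulr1 addr0 (le_trans sk)// rV_coord_le.
  by rewrite mulr0 add0r; case: ltnP => _; rewrite ?mulr1n ?rV_coord_le// mulr0n normr0.
rewrite wS -[_ *: _ + _ + _]addrA; apply: increment_le => s sk.
- by apply: dg; exact: zle.
- by apply: de; exact: zle.
Qed.

(** [Ck_on] speaks of partial derivatives only, while the chain rule needs a differential;
    continuity of the partial derivatives provides it. *)
Lemma C1_differentiable n (g : 'rV[R]_n -> R) (y : 'rV[R]_n) :
  (\forall z \near y, forall j, derivable g z (delta_mx 0 j)) ->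
  (forall j, {for y, continuous ('D_(delta_mx 0 j) g)}) ->
  differentiable g y /\
  forall h, 'd g y h = \sum_j h 0 j * 'D_(delta_mx 0 j) g y.
Proof.
move=> dg cg.
pose df (h : 'rV[R]_n) : R := \sum_j h 0 j * 'D_(delta_mx 0 j) g y.
have dfl : linear df.
  move=> a u v; rewrite /df scaler_sumr -big_split; apply: eq_bigr => j _ /=.
  by rewrite !mxE mulrDl -mulrA.
pose H := GRing.isLinear.Build R 'rV[R]_n R *:%R df dfl.
pose L : {linear 'rV[R]_n -> R} := HB.pack df H.
have Lc : continuous L.
  apply: continuous_big => [|j _ x]; first exact: add_continuous.
  apply: (@continuousM _ _ (fun h : 'rV[R]_n => h 0 j) (cst _) x).
    exact: coord_continuous.
  exact: cst_continuous.
have E : (g : 'rV[R]_n -> R^o) \o shift y =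
    cst (g y) + (L : 'rV[R]_n -> R^o) +o_ (0 : 'rV[R]_n) id.
  apply/eqaddoP => _/posnumP[e].
  (* The sum of the [n] coordinates of [h], in absolute value, is at most [n] times its maximum
     norm; [n.+1] keeps the denominator positive when [n = 0]. *)
  pose e' : R := e%:num / n.+1%:R.
  have e'0 : 0 < e' by rewrite divr_gt0.
  have cg' : \forall z \near y, forall j : 'I_n,
      `|'D_(delta_mx 0 j) g z - 'D_(delta_mx 0 j) g y| <= e'.
    apply: (@filter_forall _ _ (fun (j : 'I_n) (z : 'rV[R]_n) =>
      `|'D_(delta_mx 0 j) g z - 'D_(delta_mx 0 j) g y| <= e') (nbhs y)) => j.
    have /cvgrPdist_le /(_ _ e'0) := cg j.
    by apply: filterS => z; rewrite distrC.
  have [r /= r0 rP] := (nbhs_ballP _ _).1 (filterI dg cg').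
  have : \forall h \near (0 : 'rV[R]_n), `|h| < r.
    by apply: (nbhs_ballP _ _).2; exists r => // h; rewrite -ball_normE /= sub0r normrN.
  apply: filterS => h hr /=.
  rewrite -![(_ + _ : _ -> _) _]/(_ + _) -![(- _ : _ -> _) _]/(- _) /=.
  rewrite opprD addrA /cst.
  have zr z : `|z - y| <= `|h| -> ball y r z.
    by move=> zh; rewrite -ball_normE /= distrC (le_lt_trans zh).
  apply: le_trans (@mean_value_le n g y h e' _ _) _.
  - by move=> z /zr /rP [].
  - by move=> z /zr /rP [].
  apply: le_trans (_ : e' * (n%:R * `|h|) <= _).
    rewrite ler_pM2l// -[n in n%:R](card_ord n) mulr_natl -sumr_const.
    by rewrite ler_sum// => j _; exact: rV_coord_le.
  rewrite mulrA ler_wpM2r// /e' -mulrA ger_pMr// mulrC ler_pdivrMr// mul1r.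
  by rewrite ler_nat.
have D := diff_unique Lc E; split; last by move=> h; rewrite D.
by apply/diff_locallyP; rewrite D.
Qed.

(** [T] is only derivable along [v], so everything is restricted to the line through [x], where
    derivability in one variable is differentiability. *)
Lemma is_derive_comp (V V' W : normedModType R) (g : V' -> W) (T : V -> V')
    (x v : V) :
  differentiable g (T x) -> derivable T x v ->
  is_derive x v (g \o T) ('d g (T x) ('D_v T x)).
Proof.
move=> Dg DT.
have DT1 : differentiable (fun h : R => T (h *: v + x)) 0.
  by apply/derivable1_diffP; apply: (derivable1P _ _ _).1; exact: DT.
have Dg' : differentiable g (T ((0 : R) *: v + x)).
  by rewrite scale0r add0r.
have Dc1 : differentiable (fun h : R => (g \o T) (h *: v + x)) 0.
  by apply: (@differentiable_comp _ _ _ _ (fun h : R => T (h *: v + x)) g).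
have Dc : derivable (g \o T) x v.
  by apply/derivable1P/derivable1_diffP.
split => //.
have line (F : normedModType R) (u : V -> F) : derivable u x v ->
    'D_1 (fun h : R => u (h *: v + x)) 0 = 'D_v u x.
  move=> du; rewrite (@derive_val _ _ _ _ _ _ _ (@is_derive_line _ _ u x v 0 _)).
    by rewrite scale0r add0r.
  by rewrite scale0r add0r.
rewrite -line// deriveE// (diff_comp DT1 Dg') /=.
by rewrite -(deriveE (1 : R) DT1) line// scale0r add0r.
Qed.

Lemma chain_rule n m (g : 'rV[R]_m -> R) (T : 'rV[R]_n -> 'rV[R]_m)
    (x v : 'rV[R]_n) :
  (\forall z \near T x, forall j, derivable g z (delta_mx 0 j)) ->
  (forall j, {for T x, continuous ('D_(delta_mx 0 j) g)}) ->
  (forall j, derivable (fun x => T x 0 j) x v) ->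
  is_derive x v (g \o T)
    (\sum_j 'D_v (fun x => T x 0 j) x * 'D_(delta_mx 0 j) g (T x)).
Proof.
move=> dg cg dT.
have [Dg dgE] := C1_differentiable dg cg.
have DT : derivable T x v by apply/derivable_mxP => i j; rewrite ord1.
apply: (is_derive_eq (is_derive_comp Dg DT)).
by rewrite dgE; apply: eq_bigr => j _; rewrite derive_mx// mxE.
Qed.

Lemma chain_rule1 (V : normedModType R) (g : R -> R) (f : V -> R) (x v : V) :
  derivable g (f x) 1 -> derivable f x v ->
  is_derive x v (g \o f) ('D_v f x * 'D_1 g (f x)).
Proof.
move=> dg df; have Dg : differentiable g (f x) by apply/derivable1_diffP.
apply: (is_derive_eq (is_derive_comp Dg df)).
by rewrite -[in LHS](mulr1 ('D_v f x)) [LHS]linearZ /= -deriveE.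
Qed.

End chain_rule.

(** * Smooth functions on open sets of R^n *)

Section smooth_on_theory.
Context {R : realType}.

Section fixed_dimension.
Context {n : nat}.
Implicit Types (U V : set 'rV[R]_n) (f g : 'rV[R]_n -> R).

Lemma Ck_on_local k U f :
  (forall x, U x -> exists V, [/\ open V, V x & Ck_on k V f]) -> Ck_on k U f.
Proof.
elim: k f => [|k IH] f loc; split => //.
- move=> x; rewrite inE => /loc[V [_ Vx [cf _]]]; apply: cf.
  by rewrite inE.
- move=> x; rewrite inE => /loc[V [_ Vx [cf _]]]; apply: cf.
  by rewrite inE.
- move=> i; split.
    move=> x; rewrite inE => /loc[V [_ Vx [_ /(_ i)[df _]]]]; apply: df.
    by rewrite inE.
  by apply: IH => x /loc[V [oV Vx [_ /(_ i)[_ df]]]]; exists V.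
Qed.

Lemma smooth_on_local U f :
  (forall x, U x -> exists V, [/\ open V, V x & smooth_on V f]) ->
  smooth_on U f.
Proof.
move=> loc k; apply: Ck_on_local => x /loc[V [oV Vx sf]].
by exists V; split => //; exact: sf.
Qed.

Lemma smooth_on_subset U V f : U `<=` V -> smooth_on V f -> smooth_on U f.
Proof. by move=> UV sf k; exact: Ck_on_subset (sf k). Qed.

Lemma eq_smooth_on U f g :
  open U -> (forall x, U x -> f x = g x) -> smooth_on U f -> smooth_on U g.
Proof.
move=> oU fg sf k; apply: eq_Ck_on (sf k) => // x.
by rewrite inE => /fg.
Qed.

Lemma smooth_on_cst U (a : R) : open U -> smooth_on U (fun=> a).
Proof. by move=> oU k; exact: Ck_on_cst. Qed.

Lemma smooth_onD U f g : open U -> smooth_on U f -> smooth_on U g ->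
  smooth_on U (fun x => f x + g x).
Proof. by move=> oU sf sg k; exact: Ck_onD. Qed.

Lemma smooth_onM U f g : open U -> smooth_on U f -> smooth_on U g ->
  smooth_on U (fun x => f x * g x).
Proof. by move=> oU sf sg k; exact: Ck_onM. Qed.

Lemma smooth_onZ U (a : R) f : open U -> smooth_on U f ->
  smooth_on U (fun x => a * f x).
Proof. by move=> oU; apply: smooth_onM => //; exact: smooth_on_cst. Qed.

Lemma smooth_onB U f g : open U -> smooth_on U f -> smooth_on U g ->
  smooth_on U (fun x => f x - g x).
Proof.
move=> oU sf sg; apply: smooth_onD => //.
apply: (eq_smooth_on oU _ (smooth_onZ (-1) oU sg)) => x _.
by rewrite mulN1r.
Qed.

Lemma smooth_on_sum U (I : Type) (s : seq I) (P : pred I) F : open U ->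
  (forall i, smooth_on U (F i)) ->
  smooth_on U (fun x => \sum_(i <- s | P i) F i x).
Proof.
move=> oU sF; elim: s => [|i s IH].
  by apply: (eq_smooth_on oU _ (smooth_on_cst 0 oU)) => x _; rewrite big_nil.
have [Pi|Pi] := boolP (P i).
  apply: (eq_smooth_on oU _ (smooth_onD oU (sF i) IH)) => x _.
  by rewrite big_cons Pi.
by apply: (eq_smooth_on oU _ IH) => x _; rewrite big_cons (negbTE Pi).
Qed.

Lemma smooth_onX U f m : open U -> smooth_on U f ->
  smooth_on U (fun x => f x ^+ m).
Proof.
move=> oU sf; elim: m => [|m IH].
  by apply: (eq_smooth_on oU _ (smooth_on_cst 1 oU)) => x _; rewrite expr0.
by apply: (eq_smooth_on oU _ (smooth_onM oU sf IH)) => x _; rewrite exprS.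
Qed.

Lemma smooth_on_continuous U f : smooth_on U f ->
  forall x, U x -> {for x, continuous f}.
Proof. by move=> sf x Ux; have [cf _] := sf 0%N; apply: cf; rewrite inE. Qed.

Lemma smooth_on_derivable U f : smooth_on U f ->
  forall x i, U x -> derivable f x (delta_mx 0 i).
Proof.
move=> sf x i Ux; have [_ /(_ i)[df _]] := sf 1%N.
by apply: df; rewrite inE.
Qed.

Lemma smooth_on_derive U f i : smooth_on U f ->
  smooth_on U ('D_(delta_mx 0 i) f).
Proof. by move=> sf k; have [_ /(_ i)[_]] := sf k.+1. Qed.

Lemma coord_line (x : 'rV[R]_n) (i j : 'I_n) :
  is_derive x (delta_mx 0 i) (fun x : 'rV[R]_n => x 0 j) (i == j)%:R.
Proof.
have Did : is_derive x (delta_mx 0 i : 'rV[R]_n) id (delta_mx 0 i).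
  exact: is_derive_id.
have D : derivable (fun x : 'rV[R]_n => x 0 j) x (delta_mx 0 i).
  by have /derivable_mxP/(_ 0 j) := @ex_derive _ _ _ _ _ _ _ Did.
split => //.
have := derive_mx (@ex_derive _ _ _ _ _ _ _ Did).
rewrite (@derive_val _ _ _ _ _ _ _ Did) => /rowP/(_ j).
by rewrite !mxE eqxx /= eq_sym => <-.
Qed.

Lemma smooth_on_coord U j : open U -> smooth_on U (fun x : 'rV[R]_n => x 0 j).
Proof.
move=> oU k.
have cc : {in U, continuous (fun x : 'rV[R]_n => x 0 j)}.
  by move=> x _; exact: coord_continuous.
case: k => [|k]; split => // i; split.
  by move=> x _; have [] := coord_line x i j.
apply: (eq_Ck_on oU _ (Ck_on_cst k (i == j)%:R oU)) => x _.
by have [_ ->] := coord_line x i j.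
Qed.

End fixed_dimension.

Lemma rV_continuous (V : topologicalType) m (T : V -> 'rV[R]_m) x :
  (forall j, {for x, continuous (fun x => T x 0 j)}) -> {for x, continuous T}.
Proof.
move=> cT; apply/cvgrPdist_le => e e0.
have : \forall y \near x, forall j, `|T x 0 j - T y 0 j| <= e.
  apply: (@filter_forall _ _ (fun j y => `|T x 0 j - T y 0 j| <= e) (nbhs x)).
  by move=> j; have /cvgrPdist_le/(_ e e0) := cT j.
apply: filterS => y Ty; apply: rV_norm_le; first exact: ltW.
by move=> j; rewrite !mxE.
Qed.

(** Induction on the order with [g] generalized: by the chain rule the derivatives of [g \o T] are
    sums of products of smooth functions with ['D g \o T], to which the induction hypothesis
    applies. *)
Lemma smooth_on_comp n m (U : set 'rV[R]_n) (V : set 'rV[R]_m) g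
    (T : 'rV[R]_n -> 'rV[R]_m) : open U -> open V ->
  (forall x, U x -> V (T x)) ->
  smooth_on V g -> (forall j, smooth_on U (fun x => T x 0 j)) ->
  smooth_on U (g \o T).
Proof.
move=> oU oV UV sg sT k; elim: k g sg => [|k IH] g sg.
all: have cgT : {in U, continuous (g \o T)}.
1,3: move=> x; rewrite inE => Ux; apply: continuous_comp;
  [apply: rV_continuous => j; exact: smooth_on_continuous (sT j) x Ux
  |exact: smooth_on_continuous sg _ (UV _ Ux)].
all: split => // i.
have D x : U x -> is_derive x (delta_mx 0 i) (g \o T)
    (\sum_j 'D_(delta_mx 0 i) (fun x => T x 0 j) x *
       'D_(delta_mx 0 j) g (T x)).
  move=> Ux; apply: chain_rule.
  - have : nbhs (T x) V by apply: open_nbhs_nbhs; split => //; exact: UV.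
    by apply: filterS => z Vz j; exact: smooth_on_derivable sg _ _ Vz.
  - move=> j; apply: (smooth_on_continuous (smooth_on_derive j sg)).
    exact: UV.
  - by move=> j; exact: smooth_on_derivable (sT j) _ _ Ux.
split; first by move=> x; rewrite inE => /D[].
have : Ck_on k U (\sum_j ('D_(delta_mx 0 i) (fun x => T x 0 j) *
     (('D_(delta_mx 0 j) g) \o T))).
  elim/big_ind : _ => [|F G|j _]; [exact: Ck_on_cst|exact: Ck_onD|].
  apply: Ck_onM => //; first exact: smooth_on_derive.
  by apply: IH; exact: smooth_on_derive.
apply: eq_Ck_on => // x; rewrite inE => /D[_ ->].
by rewrite fct_sumE.
Qed.

End smooth_on_theory.

(** * Flat functions and plateaus *)

Section flat.
Context {R : realType}.

(* [p (1 / x) exp (- 1 / x)], a class closed under derivation. *)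
Definition flat (p : {poly R}) (x : R) : R :=
  if 0 < x then p.[x^-1] * expR (- x^-1) else 0.

Lemma expRN_le (m : nat) (y : R) : 0 < y -> expR (- y) <= m.+1`!%:R / y ^+ m.+1.
Proof.
move=> y0; rewrite expRN -[leRHS]invrK lef_pV2 ?posrE ?expR_gt0//; last first.
  by rewrite invr_gt0 divr_gt0// ?ltr0n ?fact_gt0// exprn_gt0.
rewrite invf_div (le_trans _ (expR_ge1Dxn m (ltW y0)))//.
by rewrite lerDr.
Qed.

Lemma poly_bound (p : {poly R}) : exists C, forall y, 1 <= y ->
  `|p.[y]| <= C * y ^+ (size p).
Proof.
exists (\sum_(i < size p) `|p`_i|) => y y1.
rewrite horner_coef (le_trans (ler_norm_sum _ _ _))// mulr_suml ler_sum// => i _.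
rewrite normrM ler_wpM2l// normrX ger0_norm; last exact: le_trans y1.
by rewrite ler_weXn2l// ltnW.
Qed.

Lemma flat_le (p : {poly R}) : exists2 C, 0 <= C & forall x, `|x| <= 1 ->
  `|flat p x| <= C * `|x|.
Proof.
have [C CP] := poly_bound p.
exists (`|C| * (size p).+1`!%:R); first by rewrite mulr_ge0.
move=> x x1; rewrite /flat; case: ifPn => x0; last first.
  by rewrite normr0 !mulr_ge0.
have y1 : 1 <= x^-1 by rewrite invf_ge1// (le_trans _ x1)// ler_norm.
have y0 : 0 < x^-1 by rewrite invr_gt0.
rewrite normrM (ger0_norm (expR_ge0 _)) (gtr0_norm x0).
apply: le_trans (_ : (`|C| * x^-1 ^+ size p) *
   ((size p).+1`!%:R / x^-1 ^+ (size p).+1) <= _).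
  apply: ler_pM => //; last exact: expRN_le.
  apply: le_trans (CP _ y1) _.
  by rewrite ler_wpM2r// ?ler_norm// exprn_ge0// ltW.
have yn0 : x^-1 ^+ size p != 0 by rewrite expf_neq0// gt_eqF.
rewrite exprS invfM invrK (mulrC x) mulrACA -!mulrA ler_wpM2l//.
by rewrite (mulrA (_ ^+ _)) mulfV// mul1r.
Qed.

Lemma is_derive_flat (p : {poly R}) (x : R) :
  is_derive x 1 (flat p) (flat ((p - p^`()) * 'X^2) x).
Proof.
have [x0|x0|->] := ltgtP x 0.
- apply: (@near_eq_is_derive _ _ _ (cst 0)); last first.
    by rewrite /flat ltNge (ltW x0) /=; exact: is_derive_cst.
  near=> y; rewrite /flat ifF//; apply/negbTE; rewrite -leNgt.
  by near: y; exact: lt_le_nbhsl.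
- apply: (@near_eq_is_derive _ _ _ (fun y : R => p.[y^-1] * expR (- y^-1))).
    near=> y; rewrite /flat ifT//.
    by near: y; exact: lt_nbhsr.
  have xn0 : x != 0 by rewrite gt_eqF.
  rewrite /flat x0.
  have Dinv : is_derive x 1 (fun y : R => y^-1) (- x ^- 2).
    have Did : derivable (@id R) x 1 by exact: derivable_id.
    split; first exact: derivableV.
    by rewrite (deriveV xn0 Did) derive_id scaler1 //.
  have Dp : is_derive x 1 (fun y : R => p.[y^-1]) ((- x ^- 2) * p^`().[x^-1]).
    have [D1 E1] := is_derive_poly p x^-1.
    have [D2 E2] := Dinv.
    by apply: is_derive_eq (chain_rule1 D1 D2) _; rewrite E1 E2.
  have De : is_derive x 1 (fun y : R => expR (- y^-1)) (x ^- 2 * expR (- x^-1)).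
    have [D1 E1] := is_derive_expR (- x^-1).
    have [D2 E2] := is_deriveN Dinv.
    have := @chain_rule1 R _ expR (- (fun y : R => y^-1)) x 1 D1 D2.
    by rewrite E1 E2 opprK.
  apply: is_derive_eq (is_deriveM Dp De) _.
  by rewrite !hornerE /GRing.scale /=; field.
- have -> : flat ((p - p^`()) * 'X^2) 0 = 0 by rewrite /flat ltxx.
  (* The factor ['X] absorbs the [h^-1] of the difference quotient at 0. *)
  have [C C0 CP] := flat_le (p * 'X).
  have L : (fun h : R => h^-1 *: ((flat p \o shift 0) (h *: 1) - flat p 0))
      @ 0^' --> (0 : R).
    apply/cvgrPdist_le => e e0.
    near=> h; rewrite sub0r normrN /= addr0 [h *: 1]mulr1.
    have h0 : h != 0 by near: h; exact: nbhs_dnbhs_neq.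
    rewrite {2}/flat ltxx subr0.
    have -> : h^-1 *: flat p h = flat (p * 'X) h.
      rewrite /flat; case: ifPn => _; last by rewrite scaler0.
      by rewrite hornerMX /GRing.scale /=; ring.
    have h1 : `|h| <= 1 by near: h; exact: dnbhs0_le.
    apply: le_trans (CP _ h1) _.
    have h2 : `|h| <= e / (C + 1).
      by near: h; apply: dnbhs0_le; rewrite divr_gt0// ltr_wpDl.
    apply: le_trans (_ : C * (e / (C + 1)) <= _); first by rewrite ler_wpM2l.
    rewrite mulrA ler_pdivrMr ?ltr_wpDl// mulrC ler_wpM2l// ?(ltW e0)//.
    by rewrite lerDl.
  split; first by apply/cvg_ex; exists 0.
  exact: cvg_lim.
Unshelve. all: by end_near. Qed.

Lemma smooth_on_flat n (U : set 'rV[R]_n) p f : open U -> smooth_on U f ->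
  smooth_on U (flat p \o f).
Proof.
move=> oU sf k; elim: k p => [|k IH] p.
all: have cgT : {in U, continuous (flat p \o f)}.
1,3: move=> x; rewrite inE => Ux; apply: continuous_comp;
  [exact: smooth_on_continuous sf x Ux
  |have [D _] := is_derive_flat p (f x);
   exact/differentiable_continuous/derivable1_diffP].
all: split => // i.
have D x : U x -> is_derive x (delta_mx 0 i) (flat p \o f)
    ('D_(delta_mx 0 i) f x * flat ((p - p^`()) * 'X^2) (f x)).
  move=> Ux; have [D1 E1] := is_derive_flat p (f x).
  apply: is_derive_eq (chain_rule1 D1 _) _; last by rewrite E1.
  exact: smooth_on_derivable sf _ _ Ux.
split; first by move=> x; rewrite inE => /D[].
have : Ck_on k U ('D_(delta_mx 0 i) f * (flat ((p - p^`()) * 'X^2) \o f)).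
  by apply: Ck_onM => //; exact: smooth_on_derive.
by apply: eq_Ck_on => // x; rewrite inE => /D[_ ->].
Qed.

Lemma flat1_gt0 x : (0 < flat 1 x) = (0 < x).
Proof.
rewrite /flat; case: ifPn => x0; last by rewrite ltxx.
by rewrite hornerC mul1r expR_gt0.
Qed.

Lemma flat1_le0 x : x <= 0 -> flat 1 x = 0.
Proof. by rewrite /flat leNgt => /negbTE ->. Qed.

Lemma flat1_ge0 x : 0 <= flat 1 x.
Proof.
by have [/flat1_le0 ->//|] := leP x 0; rewrite -flat1_gt0 => /ltW.
Qed.

Lemma flat1_le x y : x <= y -> flat 1 x <= flat 1 y.
Proof.
move=> xy; have [/flat1_le0 ->|x0] := leP x 0; first exact: flat1_ge0.
rewrite /flat x0 (lt_le_trans x0 xy) !hornerC !mul1r ler_expR lerN2.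
by rewrite lef_pV2// posrE// (lt_le_trans x0).
Qed.

(** Nesting [flat 1] in itself, instead of dividing by a sum of two flat functions, keeps the
    denominator constant. *)
Definition plateau (t : R) : R := flat 1 (flat 1 1 - flat 1 t) / flat 1 (flat 1 1).

Lemma plateau_le0 t : t <= 0 -> plateau t = 1.
Proof.
move=> t0; rewrite /plateau (flat1_le0 t0) subr0 divff// gt_eqF//.
by rewrite !flat1_gt0.
Qed.

Lemma plateau_ge1 t : 1 <= t -> plateau t = 0.
Proof.
move=> t1; rewrite /plateau (@flat1_le0 (_ - _)) ?mul0r//.
by rewrite subr_le0 flat1_le.
Qed.

Lemma smooth_on_plateau n (U : set 'rV[R]_n) f : open U -> smooth_on U f ->
  smooth_on U (plateau \o f).
Proof.
move=> oU sf.
have s1 : smooth_on U (flat 1 \o f) by exact: smooth_on_flat.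
have s2 := smooth_onB oU (smooth_on_cst (flat 1 1) oU) s1.
have s3 : smooth_on U (flat 1 \o (fun x => flat 1 1 - (flat 1 \o f) x)).
  exact: smooth_on_flat.
apply: (eq_smooth_on oU _ (smooth_onZ (flat 1 (flat 1 1))^-1 oU s3)) => x _.
by rewrite /plateau /= mulrC.
Qed.

End flat.

(** * Bump functions and bounds on derivatives *)

Section bumps.
Context {R : realType} {n : nat}.
Implicit Types (z x : 'rV[R]_n) (u v w : 'rV[R]_n -> R).

Lemma dist_continuous z : continuous (fun x => `|x - z|).
Proof.
move=> x; apply: (@continuous_comp _ _ _ (fun x => x - z) Num.norm).
  by apply: continuousB; [exact: cvg_id|exact: cst_continuous].
exact: norm_continuous.
Qed.

Lemma open_dist_lt z (r : R) : open [set x | `|x - z| < r].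
Proof.
have := @open_lt R r; move/open_comp; apply.
by move=> x _; exact: dist_continuous.
Qed.

Lemma open_dist_gt z (r : R) : open [set x | r < `|x - z|].
Proof.
have := @open_gt R r; move/open_comp; apply.
by move=> x _; exact: dist_continuous.
Qed.

Lemma closed_dist_le z (r : R) : closed [set x | `|x - z| <= r].
Proof.
rewrite (_ : mkset _ = ~` [set x | r < `|x - z|]); last first.
  by apply/seteqP; split => x /=; rewrite leNgt => /negP.
exact/open_closedC/open_dist_gt.
Qed.

Lemma compact_dist_le z (r : R) : compact [set x | `|x - z| <= r].
Proof.
apply: bounded_closed_compact; last exact: closed_dist_le.
exists (r + `|z|); split; first by rewrite num_real.
move=> M rM x /= xr; rewrite -(subrK z x) (le_trans (ler_normD _ _))//.
by rewrite (le_trans _ (ltW rM))// lerD2r.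
Qed.

Lemma smooth_bump z (r : R) : 0 < r -> exists beta : 'rV[R]_n -> R,
  [/\ smooth_on setT beta,
      exists2 s, 0 < s & forall x, `|x - z| < s -> beta x = 1 &
      forall x, r <= `|x - z| -> beta x = 0].
Proof.
move=> r0.
(* The norm is the maximum norm, which is not smooth, so [S] is the squared Euclidean distance. The
   function [t] below is [-1] at [z] and at least 1 where [S >= r ^+ 2]. *)
pose S x := \sum_(j < n) (x 0 j - z 0 j) ^+ 2.
have oT : open [set: 'rV[R]_n] by exact: openT.
have sS : smooth_on setT S.
  apply: smooth_on_sum => // j; apply: smooth_onX => //; apply: smooth_onB => //.
    exact: smooth_on_coord.
  exact: smooth_on_cst.
pose t x := 2 / r ^+ 2 * S x - 1.
have st : smooth_on setT t.
  by apply: smooth_onB => //; [exact: smooth_onZ|exact: smooth_on_cst].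
exists (plateau \o t); split; first exact: smooth_on_plateau.
- have tz : t z = - 1.
    rewrite /t /S big1 ?mulr0 ?sub0r// => j _.
    by rewrite subrr expr0n.
  have /cvgrPdist_lt/(_ 1 ltr01) := smooth_on_continuous st (I : setT z).
  move=> /nbhs_ballP[s /= s0 sP]; exists s => // x xs.
  apply: plateau_le0; have : `|t z - t x| < 1.
    by apply: sP; rewrite -ball_normE /= distrC.
  by rewrite tz ltr_norml => /andP[+ _]; lra.
- move=> x rx; apply: plateau_ge1.
  suff : r ^+ 2 <= S x.
    rewrite /t; move: (S x) => s rs.
    have r2 : 0 < r ^+ 2 by rewrite exprn_gt0.
    have : 2 <= 2 / r ^+ 2 * s; last by lra.
    by rewrite mulrAC ler_pdivlMr// ler_wpM2l.
  have [j rj] : exists j, r <= `|(x - z) 0 j|.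
    apply: contrapT => /forallNP rj.
    have : `|x - z| < r; last by rewrite ltNge rx.
    rewrite [ltLHS]/Num.Def.normr /= mx_normrE; apply/bigmax_ltP; split => //.
    by move=> [i j] _ /=; rewrite ord1 ltNge; apply/negP/rj.
  rewrite /S (bigD1 j)//= (le_trans _ (_ : (x 0 j - z 0 j) ^+ 2 <= _))//.
    rewrite -[leRHS]real_normK ?num_real// ler_pXn2r ?nnegrE ?(ltW r0)//.
    by move: rj; rewrite !mxE.
  by rewrite lerDl sumr_ge0// => i _; exact: sqr_ge0.
Qed.

Definition csmooth v :=
  smooth_on setT v /\ exists rho, forall x, rho < `|x| -> v x = 0.

Lemma derive_zero (O : set 'rV[R]_n) v i : open O -> (forall x, O x -> v x = 0) ->
  forall x, O x -> 'D_(delta_mx 0 i) v x = 0.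
Proof.
move=> oO v0 x Ox; rewrite (@near_eq_derive _ _ _ v (cst 0)) ?derive_cst//.
have : nbhs x O by exact: open_nbhs_nbhs.
by apply: filterS => y /v0 ->.
Qed.

Lemma csmooth_derive v i : csmooth v -> csmooth ('D_(delta_mx 0 i) v).
Proof.
move=> [sv [rho v0]]; split; first exact: smooth_on_derive.
exists rho => x xr; apply: (@derive_zero [set x | rho < `|x - 0|]).
- exact: open_dist_gt.
- by move=> y /=; rewrite subr0; exact: v0.
- by rewrite /= subr0.
Qed.

Lemma csmoothM v w : smooth_on setT w -> csmooth v -> csmooth (fun x => w x * v x).
Proof.
move=> sw [sv [rho v0]]; split; first by apply: smooth_onM => //; exact: openT.
by exists rho => x /v0 ->; rewrite mulr0.
Qed.

Lemma csmooth_bounded v : csmooth v -> exists2 C, 0 <= C & forall x, `|v x| <= C.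
Proof.
move=> [sv [rho v0]].
pose A := [set x : 'rV[R]_n | `|x - 0| <= `|rho|].
have A0 : A !=set0 by exists 0; rewrite /A /= subrr normr0.
have cv : {within A, continuous (fun x => `|v x|)}.
  apply: continuous_subspaceT => x.
  apply: (@continuous_comp _ _ _ v Num.norm); last exact: norm_continuous.
  exact: (smooth_on_continuous sv).
have [c _ cP] := EVT_max_rV A0 (@compact_dist_le 0 _) cv.
exists `|v c| => // x; have [xr|xr] := leP `|x| `|rho|.
  by apply: cP; rewrite inE /A /= subr0.
by rewrite v0 ?normr0// (le_lt_trans _ xr)// ler_norm.
Qed.

(** A bound on the [C^m] norm, as a predicate that takes no supremum. *)
Fixpoint dbound (m : nat) (C : R) v : Prop :=
  (forall x, `|v x| <= C) /\
  match m with
  | 0 => True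
  | m'.+1 => forall i, dbound m' C ('D_(delta_mx 0 i) v)
  end.

Lemma dbound_le m C C' v : C <= C' -> dbound m C v -> dbound m C' v.
Proof.
move=> CC; elim: m v => [|m IH] v [vC dv]; split => //.
- by move=> x; exact: le_trans CC.
- by move=> x; exact: le_trans CC.
- by move=> i; exact: (IH _ (dv i)).
Qed.

Lemma dboundW m k C v : (m <= k)%N -> dbound k C v -> dbound m C v.
Proof.
by elim: m k v => [|m IH] [|k] v //= mk [vC dv]; split => // i; exact: (IH k).
Qed.

Lemma csmooth_dbound m v : csmooth v -> exists2 C, 0 <= C & dbound m C v.
Proof.
elim: m v => [|m IH] v cv; have [C C0 vC] := csmooth_bounded cv; first by exists C.
have /choice[D DP] : forall i : 'I_n, exists D, 0 <= D /\
    dbound m D ('D_(delta_mx 0 i) v).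
  by move=> i; have [D D0 DP] := IH _ (csmooth_derive i cv); exists D.
have SD i : D i <= C + \sum_i D i.
  rewrite (bigD1 i)//= ler_wpDl// lerDl sumr_ge0// => j _.
  by have [] := DP j.
exists (C + \sum_i D i); first by rewrite addr_ge0// sumr_ge0// => i _; have [] := DP i.
split => [x|i].
  by rewrite (le_trans (vC x))// lerDl sumr_ge0// => i _; have [] := DP i.
by apply: (dbound_le (SD i)); have [] := DP i.
Qed.

Lemma dboundD m C C' v w : smooth_on setT v -> smooth_on setT w ->
  dbound m C v -> dbound m C' w -> dbound m (C + C') (fun x => v x + w x).
Proof.
elim: m v w => [|m IH] v w sv sw [vC dv] [wC dw]; split => //.
- by move=> x; rewrite (le_trans (ler_normD _ _))// lerD.
- by move=> x; rewrite (le_trans (ler_normD _ _))// lerD.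
- move=> i; have -> : 'D_(delta_mx 0 i) (fun x => v x + w x) =
      (fun x => 'D_(delta_mx 0 i) v x + 'D_(delta_mx 0 i) w x).
    by apply/funext => x; apply: deriveD; exact: (@smooth_on_derivable _ _ setT).
  by apply: IH; [exact: (smooth_on_derive i sv)|exact: (smooth_on_derive i sw)
    |exact: dv|exact: dw].
Qed.

Lemma dboundZ m C v (a : R) : smooth_on setT v ->
  dbound m C v -> dbound m (`|a| * C) (fun x => a * v x).
Proof.
elim: m v => [|m IH] v sv [vC dv]; split => //.
- by move=> x; rewrite normrM ler_wpM2l.
- by move=> x; rewrite normrM ler_wpM2l.
- move=> i; have -> : 'D_(delta_mx 0 i) (fun x => a * v x) =
      (fun x => a * 'D_(delta_mx 0 i) v x).
    by apply/funext => x; apply: deriveZ; exact: (@smooth_on_derivable _ _ setT).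
  by apply: IH; [exact: (smooth_on_derive i sv)|exact: dv].
Qed.

Lemma csmooth_small m v (e : R) : csmooth v -> 0 < e ->
  exists2 c, 0 < c & dbound m e (fun x => c * v x).
Proof.
move=> cv e0; have [C C0 vC] := csmooth_dbound m cv.
have C1 : 0 < C + 1 by rewrite ltr_wpDl.
exists (e / (C + 1)); first by rewrite divr_gt0.
apply: dbound_le (dboundZ _ _ vC); last by case: cv.
by rewrite gtr0_norm ?divr_gt0// mulrAC ler_pdivrMr// ler_wpM2l ?(ltW e0)// lerDl.
Qed.

End bumps.

(** * Cutoffs along the zero set of a function *)

Section rescaling.
Context {R : realType} {n : nat}.

(** For [phi t = t ^+ j * psi t] this is [f ^+ j * y], cut off by [psi (f / e)]. The domain of [phi]
    is the space of rows of length 1, so that the calculus on R^n covers it. *)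
Definition rescale (phi : 'rV[R]_1 -> R) (f y : 'rV[R]_n -> R) (j : nat) (e : R)
  (x : 'rV[R]_n) : R := e ^+ j * phi (const_mx (e^-1 * f x)) * y x.

Lemma smooth_const_mx_comp (phi : 'rV[R]_1 -> R) (f : 'rV[R]_n -> R) (e : R) :
  smooth_on setT phi -> smooth_on setT f ->
  smooth_on setT (fun x => phi (const_mx (e^-1 * f x))).
Proof.
move=> sphi sf.
apply: (smooth_on_comp openT openT _ sphi) => // j.
apply: (eq_smooth_on openT _ (smooth_onZ e^-1 openT sf)) => x _.
by rewrite mxE.
Qed.

Lemma smooth_rescale phi f y j e : smooth_on setT phi -> smooth_on setT f ->
  smooth_on setT y -> smooth_on setT (rescale phi f y j e).
Proof.
move=> sphi sf sy; apply: smooth_onM => //; first exact: openT.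
by apply: smooth_onZ; [exact: openT|exact: smooth_const_mx_comp].
Qed.

Lemma derive_rescale phi f y j (e : R) i x : 0 < e ->
  smooth_on setT phi -> smooth_on setT f -> smooth_on setT y ->
  'D_(delta_mx 0 i) (rescale phi f y j.+1 e) x =
    rescale ('D_(delta_mx 0 0) phi) f
      (fun x => 'D_(delta_mx 0 i) f x * y x) j e x +
    rescale phi f ('D_(delta_mx 0 i) y) j.+1 e x.
Proof.
move=> e0 sphi sf sy; set v := delta_mx 0 i.
have dfx : derivable f x v by exact: (@smooth_on_derivable _ _ setT).
have dy : derivable y x v by exact: (@smooth_on_derivable _ _ setT).
pose T (x : 'rV[R]_n) : 'rV[R]_1 := const_mx (e^-1 * f x).
have TE : (fun x => T x 0 0) = (fun x => e^-1 * f x).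
  by apply/funext => z; rewrite mxE.
have [D E] : is_derive x v (phi \o T)
    (e^-1 * 'D_v f x * 'D_(delta_mx 0 0) phi (T x)).
  apply: (is_derive_eq (@chain_rule R _ _ phi T x v _ _ _)).
  - apply: (@filterE _ (nbhs (T x) : set_system 'rV[R]_1)) => z j'.
    exact: (@smooth_on_derivable _ _ setT).
  - by move=> j'; apply: (smooth_on_continuous (smooth_on_derive j' sphi)).
  - move=> j'; rewrite ord1 TE; exact: derivableZ.
  - by rewrite big_ord1 TE; congr (_ * _); exact: deriveZ.
have D' : derivable (fun x => e ^+ j.+1 * (phi \o T) x) x v by exact: derivableZ.
have -> : rescale phi f y j.+1 e = (fun x => e ^+ j.+1 * (phi \o T) x) * y.
  by [].
rewrite deriveM//.
have -> : 'D_v (fun x0 => e ^+ j.+1 * (phi \o T) x0) x = e ^+ j.+1 * 'D_v (phi \o T) x.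
  exact: deriveZ.
rewrite E /rescale /T /GRing.scale /= exprS; field.
by rewrite gt_eqF.
Qed.

(** Each derivative falling on [phi] costs a factor [e^-1]. Since fewer than [j] derivatives are
    taken, one factor [e] of [e ^+ j] is left over. *)
Lemma rescale_dbound m (phi : 'rV[R]_1 -> R) (f y : 'rV[R]_n -> R) j :
  csmooth phi -> smooth_on setT f ->
  csmooth y -> (m < j)%N ->
  exists2 C, 0 <= C & forall e, 0 < e -> e <= 1 ->
    dbound m (C * e) (rescale phi f y j e).
Proof.
elim: m phi y j => [|m IH] phi y [//|j] cphi sf cy mj.
all: have [Cp Cp0 phiC] := csmooth_bounded cphi.
all: have [Cy Cy0 yC] := csmooth_bounded cy.
all: have B e x : 0 < e -> e <= 1 -> `|rescale phi f y j.+1 e x| <= Cp * Cy * e.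
1,3: move=> e0 e1; rewrite /rescale 2!normrM -mulrA mulrC ler_pM// ?ler_pM//;
  by rewrite exprS normrM gtr0_norm// ler_piMr ?(ltW e0)// normrX gtr0_norm//
    exprn_ile1// ltW.
  exists (Cp * Cy); first exact: mulr_ge0.
  by move=> e e0 e1; split => // x; exact: B.
have [sphi _] := cphi; have [sy _] := cy.
have cfy i : csmooth (fun x => 'D_(delta_mx 0 i) f x * y x).
  by apply: csmoothM => //; exact: smooth_on_derive.
have /choice[D DP] : forall i : 'I_n, exists D, 0 <= D /\
    forall e, 0 < e -> e <= 1 ->
    dbound m (D * e) ('D_(delta_mx 0 i) (rescale phi f y j.+1 e)).
  move=> i.
  have [C1 C10 C1P] := IH _ _ j (csmooth_derive 0 cphi) sf (cfy i) mj.
  have [C2 C20 C2P] := IH _ _ j.+1 cphi sf (csmooth_derive i cy) (leqW mj).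
  exists (C1 + C2); split; first exact: addr_ge0.
  move=> e e0 e1; have -> : 'D_(delta_mx 0 i) (rescale phi f y j.+1 e) = fun x =>
      rescale ('D_(delta_mx 0 0) phi) f
      (fun x => 'D_(delta_mx 0 i) f x * y x) j e x +
      rescale phi f ('D_(delta_mx 0 i) y) j.+1 e x.
    by apply/funext => x; exact: derive_rescale.
  rewrite mulrDl; apply: dboundD; [| |exact: C1P|exact: C2P].
  - apply: smooth_rescale => //; first exact: smooth_on_derive.
    by case: (cfy i).
  - by apply: smooth_rescale => //; exact: smooth_on_derive.
exists (Cp * Cy + \sum_i D i).
  by rewrite addr_ge0 ?mulr_ge0// sumr_ge0// => i _; have [] := DP i.
move=> e e0 e1; split => [x|i].
  rewrite (le_trans (B e x e0 e1))// ler_wpM2r ?(ltW e0)// lerDl sumr_ge0// => i _.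
  by have [] := DP i.
have [D0 /(_ e e0 e1)] := DP i; apply: dbound_le; rewrite ler_wpM2r ?(ltW e0)//.
rewrite (bigD1 i)//= ler_wpDl ?mulr_ge0// lerDl sumr_ge0// => j' _.
by have [] := DP j'.
Qed.

End rescaling.

(** * Gluing along shrinking shells *)

Section gluing.
Context {R : realType} {n : nat}.
Variables (z : 'rV[R]_n) (a : nat -> R) (F : nat -> set 'rV[R]_n).
Hypothesis a_gt0 : forall k, 0 < a k.
Hypothesis a_decr : forall k, a k.+1 <= a k.
Hypothesis a_cvg0 : forall e, 0 < e -> exists k, a k < e.
Hypothesis F_closed : forall k, closed (F k).
Hypothesis F_shell : forall k x, F k x -> a k.+1 < `|x - z| < a k.
Implicit Types (v : nat -> 'rV[R]_n -> R).

(** Off all the [F k] the default index 0 does no harm, because a gluable [v 0] vanishes there. *)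
Definition glue v (x : 'rV[R]_n) : R := v (xget 0%N [set k | F k x]) x.

(** Points of [F k] are farther than [a k.+1] from [z], so the last condition makes all derivatives
    small compared with the distance to [z]. *)
Definition gluable v :=
  [/\ forall k, smooth_on setT (v k),
      forall k x, ~ F k x -> v k x = 0 &
      forall m e, 0 < e -> exists K, forall k, (K <= k)%N ->
        dbound m (e * a k.+1) (v k)].

Lemma a_le k l : (k <= l)%N -> a l <= a k.
Proof.
by move=> /subnK <-; elim: (l - k)%N => //= i; apply: le_trans (a_decr _).
Qed.

Lemma F_inj k l x : F k x -> F l x -> k = l.
Proof.
move=> /F_shell/andP[k1 k2] /F_shell/andP[l1 l2].
case: (ltngtP k l) => // kl.
- by have := lt_trans k1 (lt_le_trans l2 (a_le kl)); rewrite ltxx.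
- by have := lt_trans l1 (lt_le_trans k2 (a_le kl)); rewrite ltxx.
Qed.

Lemma glueE v k x : F k x -> glue v x = v k x.
Proof.
move=> Fkx; rewrite /glue; congr (v _ x).
apply: (@F_inj _ _ x) => //.
exact: (@xgetPex _ 0%N [set k | F k x] (ex_intro _ k Fkx)).
Qed.

Lemma glue0 v x : gluable v -> (forall k, ~ F k x) -> glue v x = 0.
Proof. by move=> [_ v0 _] Fx; exact/v0/Fx. Qed.

Lemma glue_far v K x : gluable v -> a K < `|x - z| ->
  glue v x = \sum_(k < K) v k x.
Proof.
move=> gv Kx; have [_ v0 _] := gv.
have [[k Fkx]|/forallNP Fx] := pselect (exists k, F k x); last first.
  by rewrite glue0// big1// => k _; rewrite v0.
rewrite (glueE v Fkx).
have kK : (k < K)%N.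
  rewrite ltnNge; apply/negP => /a_le Kk.
  have /andP[_ kx] := F_shell Fkx.
  by have := lt_trans Kx (lt_le_trans kx Kk); rewrite ltxx.
rewrite (bigD1 (Ordinal kK))//= big1 ?addr0// => l lk; apply: v0 => Flx.
by move/eqP: lk; apply; apply/val_inj/(F_inj Flx).
Qed.

Lemma glue_near v e : gluable v -> 0 < e ->
  exists2 r, 0 < r & forall x, `|x - z| < r -> `|glue v x| <= e * `|x - z|.
Proof.
move=> gv e0; have [_ _ /(_ 0%N e e0)[K KP]] := gv.
exists (a K) => // x xK.
have [[k Fkx]|/forallNP Fx] := pselect (exists k, F k x); last first.
  by rewrite glue0// normr0 mulr_ge0// ltW.
rewrite (glueE v Fkx); have /andP[kx _] := F_shell Fkx.
have Kk : (K <= k)%N.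
  rewrite leqNgt; apply/negP => /a_le Kk.
  by have := lt_trans kx (lt_le_trans xK Kk); rewrite ltxx.
have [vk _] := KP k Kk; rewrite (le_trans (vk x))// ler_wpM2l ?(ltW e0)//.
exact: ltW.
Qed.

Lemma gluable_derive v i : gluable v ->
  gluable (fun k => 'D_(delta_mx 0 i) (v k)).
Proof.
move=> [sv v0 vb]; split.
- by move=> k; exact: (smooth_on_derive i (sv k)).
- move=> k x Fx; apply: (@derive_zero _ _ (~` F k)); last exact: Fx.
    exact: closed_openC.
  by move=> y Fy; exact: (v0 k y Fy).
- move=> m e e0; have [K KP] := vb m.+1 e e0.
  by exists K => k /KP[_ /(_ i)].
Qed.

Lemma glue_center v : gluable v -> glue v z = 0.
Proof.
move=> gv; apply: glue0 => // k /F_shell; rewrite subrr normr0.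
by rewrite ltNge ltW.
Qed.

Lemma glue_far_near v x : gluable v -> x != z ->
  exists K, a K < `|x - z| /\ \forall y \near x, \sum_(k < K) v k y = glue v y.
Proof.
move=> gv xz; have xz0 : 0 < `|x - z| by rewrite normr_gt0 subr_eq0.
have [K KP] := a_cvg0 xz0; exists K; split => //.
have : nbhs x [set y | a K < `|y - z|].
  by apply: open_nbhs_nbhs; split => //; exact: open_dist_gt.
by apply: filterS => y yK; rewrite -glue_far.
Qed.

Lemma smooth_partial_sum v K : gluable v ->
  smooth_on setT (fun y => \sum_(k < K) v k y).
Proof.
by move=> [sv _ _]; apply: smooth_on_sum => //; exact: openT.
Qed.

Lemma glue_continuous v x : gluable v -> {for x, continuous (glue v)}.
Proof.
move=> gv; have [->|xz] := eqVneq x z.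
  apply/(@cvgrPdist_le _ R^o _ (nbhs z)) => e e0; rewrite glue_center//.
  have [r r0 rP] := glue_near gv ltr01.
  apply/nbhs_ballP; exists (Num.min r e) => /=; first by rewrite lt_min r0.
  move=> y; rewrite -ball_normE /= distrC lt_min => /andP[yr ye].
  by rewrite sub0r normrN (le_trans (rP y yr))// mul1r ltW.
have [K [KP nK]] := glue_far_near gv xz.
change (glue v @ x --> glue v x); rewrite (glue_far gv KP).
apply: cvg_trans (smooth_on_continuous (smooth_partial_sum K gv) (I : setT x)).
exact: (@near_eq_cvg _ _ (nbhs x) _ _ _ nK).
Qed.

(** Away from [z] the glued function is locally a finite sum; at [z] the difference quotient is
    squeezed to 0. As the derivatives are gluable again, smoothness follows by induction. *)
Lemma is_derive_glue v x i : gluable v ->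
  is_derive x (delta_mx 0 i) (glue v)
    (glue (fun k => 'D_(delta_mx 0 i) (v k)) x).
Proof.
move=> gv; have [sv v0 vb] := gv.
have gdv := gluable_derive i gv.
have [->|xz] := eqVneq x z.
  rewrite (glue_center gdv).
  have L : (fun h : R => h^-1 *: ((glue v \o shift z) (h *: delta_mx 0 i)
      - glue v z)) @ 0^' --> (0 : R).
    apply/cvgrPdist_le => e e0.
    have [r r0 rP] := glue_near gv e0.
    near=> h; rewrite sub0r normrN /= (glue_center gv) subr0.
    have h0 : h != 0 by near: h; exact: nbhs_dnbhs_neq.
    have delta : `|h *: delta_mx 0 i : 'rV[R]_n| <= `|h|.
      rewrite normrZ ler_piMr//; apply: rV_norm_le => // j.
      by rewrite mxE; case: (_ && _); rewrite ?normr1 ?normr0.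
    have hr : `|h| < r by near: h; exact: dnbhs0_lt.
    rewrite normrM normfV ler_pdivrMl ?normr_gt0// mulrC.
    apply: le_trans (rP _ _) _; rewrite addrK; first exact: le_lt_trans hr.
    by rewrite ler_wpM2l// ltW.
  split; first by apply/cvg_ex; exists 0.
  exact: cvg_lim.
have [K [KP nK]] := glue_far_near gv xz.
apply: (near_eq_is_derive nK).
rewrite (glue_far gdv KP).
have -> : (fun y => \sum_(k < K) v k y) = \sum_(k < K) v k.
  by apply/funext => y; rewrite fct_sumE.
apply: is_derive_sum => k; apply: derivableP.
exact: (@smooth_on_derivable _ _ setT).
Unshelve. all: by end_near. Qed.

Lemma smooth_glue v : gluable v -> smooth_on setT (glue v).
Proof.
move=> gv k; elim: k v gv => [|k IH] v gv; split => //.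
- by move=> x _; exact: glue_continuous.
- by move=> x _; exact: glue_continuous.
- move=> i; split; first by move=> x _; have [] := is_derive_glue x i gv.
  have -> : 'D_(delta_mx 0 i) (glue v) = glue (fun k => 'D_(delta_mx 0 i) (v k)).
    by apply/funext => x; have [_] := is_derive_glue x i gv.
  by apply: IH; exact: gluable_derive.
Qed.

End gluing.

Section interpolation.
Context {R : realType} {n : nat}.
Implicit Types (z x q : 'rV[R]_n) (f v y : 'rV[R]_n -> R).

(** A diagonal condition is enough: [v k] is controlled up to order [k] with a factor [1 / k.+1],
    which eventually beats every order [m] and every [e]. *)
Lemma interpolation z (a r : nat -> R) (q : nat -> 'rV[R]_n)
    (v : nat -> 'rV[R]_n -> R) :
  (forall k, 0 < a k) -> (forall k, a k.+1 <= a k) ->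
  (forall e, 0 < e -> exists k, a k < e) ->
  (forall k x, `|x - q k| <= r k -> a k.+1 < `|x - z| < a k) ->
  (forall k, smooth_on setT (v k)) ->
  (forall k x, r k < `|x - q k| -> v k x = 0) ->
  (forall k, dbound k (a k.+1 / k.+1%:R) (v k)) ->
  exists2 w, smooth_on setT w &
    forall k x, `|x - q k| <= r k -> w x = v k x.
Proof.
move=> a0 adec acvg shell sv v0 vb.
pose F k := [set x | `|x - q k| <= r k].
have F_closed k : closed (F k) by exact: closed_dist_le.
have gv : gluable a F v.
  split => // [k x /negP|m e e0].
    by rewrite -ltNge; exact: v0.
  pose K := maxn m (Num.bound e^-1); exists K => k; rewrite geq_max => /andP[mk ek].
  apply: (dboundW mk); apply: dbound_le (vb k).
  rewrite mulrC ler_wpM2r ?(ltW (a0 _))//.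
  rewrite -[leRHS]invrK lef_pV2 ?posrE ?invr_gt0 ?ltr0n//.
  have /archi_boundP/ltW et : 0 <= e^-1 by rewrite invr_ge0 ltW.
  by rewrite (le_trans et)// ler_nat leqW.
exists (glue F v).
  exact: (@smooth_glue _ _ z a F a0 adec acvg F_closed shell v gv).
by move=> k x xk; exact: (@glueE _ _ z a F adec shell v k x).
Qed.

Lemma smooth_cutoff (U : set 'rV[R]_n) q (r : R) f v : open U ->
  (forall x, `|x - q| <= r -> U x) -> smooth_on setT v ->
  (forall x, r <= `|x - q| -> v x = 0) -> smooth_on U f ->
  csmooth (fun x => f x * v x).
Proof.
move=> oU qU sv v0 sf; split.
  apply: smooth_on_local => x _; have [xr|xr] := leP `|x - q| r.
    exists U; split => //; first exact: qU.
    by apply: smooth_onM => //; apply: smooth_on_subset sv.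
  have oV : open [set x | r < `|x - q|] by exact: open_dist_gt.
  exists [set x | r < `|x - q|]; split => //.
  apply: (eq_smooth_on oV _ (smooth_on_cst 0 oV)) => w /= wr.
  by rewrite v0 ?mulr0// ltW.
exists (r + `|q|) => x xr; rewrite v0 ?mulr0// -(lerD2r `|q|) (le_trans (ltW xr))//.
by rewrite -{1}(subrK q x) ler_normD.
Qed.

Lemma plateau_bump1 : exists psi : 'rV[R]_1 -> R,
  [/\ csmooth psi & exists2 s, 0 < s & forall t : R, `|t| < s -> psi (const_mx t) = 1].
Proof.
have [psi [spsi [s s0 psi1] psi0]] := @smooth_bump R 1 0 1 ltr01.
exists psi; split.
  by split => //; exists 1 => x x1; rewrite psi0// subr0 ltW.
exists s => // t ts; apply: psi1; rewrite subr0.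
apply: le_lt_trans ts; apply: rV_norm_le => // j; by rewrite mxE.
Qed.

(** The scale [e] of the cutoff is chosen after [d], so the size of [d] is irrelevant; [f q = 0]
    ensures that the cutoff equals 1 near [q]. *)
Lemma small_power k q (d eta : R) f y : smooth_on setT f -> csmooth y ->
  f q = 0 -> 0 < eta ->
  exists u, [/\ smooth_on setT u, forall x, y x = 0 -> u x = 0,
    dbound k eta u &
    exists2 s, 0 < s & forall x, `|x - q| < s -> u x = d * (f x ^+ k.+1 * y x)].
Proof.
move=> sf cy fq eta0; have [sy _] := cy.
have [psi [cpsi [s s0 psi1]]] := plateau_bump1.
pose phi (t : 'rV[R]_1) := t 0 0 ^+ k.+1 * psi t.
have cphi : csmooth phi.
  apply: csmoothM => //; apply: smooth_onX; first exact: openT.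
  exact/smooth_on_coord/openT.
have [sphi _] := cphi.
have [C C0 CP] := rescale_dbound cphi sf cy (ltnSn k).
pose e := Num.min 1 (eta / (`|d| * C + 1)).
have dC0 : 0 < `|d| * C + 1 by rewrite ltr_wpDl// mulr_ge0.
have e0 : 0 < e by rewrite lt_min ltr01 divr_gt0.
have e1 : e <= 1 by rewrite ge_min lexx.
have sr : smooth_on setT (rescale phi f y k.+1 e) by exact: smooth_rescale.
exists (fun x => d * rescale phi f y k.+1 e x); split.
- by apply: smooth_onZ => //; exact: openT.
- by move=> x yx; rewrite /rescale yx !mulr0.
- apply: dbound_le (dboundZ d sr (CP e e0 e1)).
  apply: le_trans (_ : (`|d| * C) * (eta / (`|d| * C + 1)) <= _).
    rewrite mulrA ler_wpM2l ?mulr_ge0//.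
    by rewrite /e ge_min lexx orbT.
  rewrite mulrA ler_pdivrMr// mulrC ler_wpM2l ?(ltW eta0)// lerDl//.
- have es0 : 0 < e * s by rewrite mulr_gt0.
  have /cvgrPdist_lt/(_ _ es0) := smooth_on_continuous sf (I : setT q).
  move=> /nbhs_ballP[t /= t0 tP]; exists t => // x xt; congr (_ * _).
  have fx : `|f x| < e * s.
    have := tP x; rewrite -ball_normE /= distrC => /(_ xt).
    by rewrite fq sub0r normrN.
  rewrite /rescale /phi psi1; last first.
    by rewrite normrM normfV (gtr0_norm e0) mulrC ltr_pdivrMr// mulrC.
  rewrite mxE mulr1 exprMn exprVn !mulrA mulfV ?mul1r//.
  by rewrite expf_neq0// gt_eqF.
Qed.

End interpolation.

(** * Smooth functions and sections *)

Section manifold_functions.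
Context {R : realType} {n : nat} {M : manifold R n}.
Implicit Types (U V : set M) (f g : Cinf M) (c : chart R n M).

Lemma CinfP f g : (forall x, f x = g x) -> f = g.
Proof. by move=> fg; apply: val_inj; apply/funext. Qed.

Lemma CinfD f g x : (f + g) x = f x + g x. Proof. by []. Qed.
Lemma CinfM f g x : (f * g) x = f x * g x. Proof. by []. Qed.
Lemma CinfZ (a : R) f x : (a *: f) x = a * f x. Proof. by []. Qed.
Lemma CinfN f x : (- f) x = - f x. Proof. by []. Qed.
Lemma Cinf1 x : (1 : Cinf M) x = 1. Proof. by []. Qed.

Lemma Cinf_smooth_sub U f : smooth_in U f.
Proof. exact: (@smooth_in_subset _ _ _ U setT f (@subsetT _ U) (Cinf_smooth_in f)). Qed.

Lemma smooth_in_local U (h : M -> R) :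
  (forall x, U x -> exists V, [/\ open V, V x & smooth_in V h]) ->
  smooth_in U h.
Proof.
move=> loc c ac; apply: smooth_on_local => v [cv Uv].
have [V [oV Vx sV]] := loc _ Uv.
exists (cimg c `&` cinv c @^-1` V); split => //.
  exact: chart_preimage_open.
exact: sV.
Qed.

Lemma open_cmap_preimage c (W : set 'rV[R]_n) :
  open W -> open (cdom c `&` cmap c @^-1` W).
Proof.
move=> oW; rewrite openE => x [cx Wx]; apply: filterI.
  by apply: open_nbhs_nbhs; split => //; exact: cdom_open.
apply: (@cmap_continuous _ _ _ c x); first exact: mem_set.
by apply: open_nbhs_nbhs.
Qed.

Lemma smooth_in_cmap c (g : 'rV[R]_n -> R) : atlas c -> smooth_on setT g ->
  smooth_in (cdom c) (g \o cmap c).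
Proof.
move=> ac sg d ad.
have -> : (g \o cmap c) \o cinv d = g \o (fun v => cmap c (cinv d v)) by [].
apply: (smooth_on_comp _ openT _ sg) => // [|j].
  exact/chart_preimage_open/cdom_open.
exact: atlas_smooth.
Qed.

Lemma Cinf_local (h : M -> R) :
  (forall x, exists V, exists2 g : Cinf M, open V /\ V x & forall y, V y -> h y = g y) ->
  exists f : Cinf M, forall x, f x = h x.
Proof.
move=> loc.
have sh : smooth_in setT h.
  apply: smooth_in_local => x _; have [V [g [oV Vx] Vg]] := loc x.
  exists V; split => //; apply: (@eq_smooth_in _ _ _ _ g) => //.
    by move=> y; rewrite inE => /Vg.
  exact: Cinf_smooth_sub.
have ph : h \in smooth_pred M by apply/asboolP.
by exists (MkCinf ph).
Qed.

(** Extension by zero: [U] and the complement of [K] are open and cover the manifold, and the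
    product vanishes on the latter. *)
Lemma Cinf_extend U (K : set M) f (h : M -> R) :
  open U -> closed K -> K `<=` U -> (forall x, ~ K x -> f x = 0) ->
  smooth_in U h -> exists g : Cinf M, forall x, g x = f x * h x.
Proof.
move=> oU cK KU f0 sh.
have sfh : smooth_in setT (fun x => f x * h x).
  apply: smooth_in_local => x _; have [Kx|Kx] := pselect (K x).
    exists U; split => //; first exact: KU.
    apply: smooth_inM => //; exact: Cinf_smooth_sub.
  exists (~` K); split => //; first exact: closed_openC.
  apply: (@eq_smooth_in _ _ _ _ (cst 0)).
  - exact: closed_openC.
  - by move=> y; rewrite inE /= => /f0 ->; rewrite mul0r.
  - exact/smooth_in_cst/closed_openC.
have ph : (fun x => f x * h x) \in smooth_pred M by apply/asboolP.
by exists (MkCinf ph).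
Qed.

Lemma chart_ball c U x : open U -> cdom c x -> U x ->
  exists2 r, 0 < r & forall v, `|v - cmap c x| <= r -> cimg c v /\ U (cinv c v).
Proof.
move=> oU cx Ux.
have oW : open (cimg c `&` cinv c @^-1` U) by exact: chart_preimage_open.
have : nbhs (cmap c x) (cimg c `&` cinv c @^-1` U).
  apply: open_nbhs_nbhs; split => //; split; first exact: cmap_img.
  by rewrite /= cmapK ?inE.
move=> /nbhs_ballP[r /= r0 rP]; exists (r / 2); first by rewrite divr_gt0.
move=> v vr; apply: rP; rewrite -ball_normE /= distrC (le_lt_trans vr)//.
by rewrite ltr_pdivrMr// ltr_pMr// ltr1n.
Qed.

Lemma Cinf_bump U p : open U -> U p -> exists f V K,
  [/\ open V, V p, V `<=` U & forall x, V x -> f x = 1] /\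
  [/\ closed K, K `<=` U & forall x, ~ K x -> f x = 0].
Proof.
move=> oU Up; have [c ac cp] := atlas_cover p.
have [r r0 rP] := chart_ball oU cp Up.
have [beta [sb [s s0 b1] b0]] := smooth_bump (cmap c p) r0.
pose K := cinv c @` [set v | `|v - cmap c p| <= r].
pose h x := if pselect (cdom c x) then beta (cmap c x) else 0.
have hc x : cdom c x -> h x = beta (cmap c x) by rewrite /h; case: pselect.
have KU : K `<=` U by move=> _ [v /rP[_ Uv] <-].
have Kc : K `<=` cdom c by move=> _ [v /rP[cv _] <-]; exact: cinv_dom.
have h0 x : ~ K x -> h x = 0.
  move=> Kx; rewrite /h; case: pselect => // cx; apply: b0.
  rewrite leNgt; apply/negP => /ltW xr; apply: Kx; exists (cmap c x) => //.
  by rewrite cmapK// inE.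
(* The Hausdorff condition enters here: [K] is the image of a closed ball, hence compact, hence
   closed, which makes the extension by zero smooth. *)
have cK : closed K.
  apply: compact_closed; first exact: manifold_hausdorff.
  apply: continuous_compact; last exact: compact_dist_le.
  apply: continuous_in_subspaceT => v; rewrite inE /= => /rP[cv _].
  by apply: cinv_continuous; rewrite inE.
have sh : smooth_in setT h.
  apply: smooth_in_local => x _; have [Kx|Kx] := pselect (K x).
    exists (cdom c); split; [exact: cdom_open|exact: Kc|].
    apply: (@eq_smooth_in _ _ _ _ (beta \o cmap c)); first exact: cdom_open.
      by move=> y; rewrite inE => /hc ->.
    exact: smooth_in_cmap.
  exists (~` K); split => //; first exact: closed_openC.
  apply: (@eq_smooth_in _ _ _ _ (cst 0)).
  - exact: closed_openC.
  - by move=> y; rewrite inE /= => /h0 ->.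
  - exact/smooth_in_cst/closed_openC.
have ph : h \in smooth_pred M by apply/asboolP.
exists (MkCinf ph), (U `&` (cdom c `&` cmap c @^-1` [set v | `|v - cmap c p| < s])), K.
split; split => //.
- by apply: openI => //; exact/open_cmap_preimage/open_dist_lt.
- by split => //; split => //=; rewrite subrr normr0.
- by move=> x [_ [cx xs]]; rewrite /= hc// b1.
Qed.

End manifold_functions.

Section bundle_sections.
Context {R : realType} {n : nat} {M : manifold R n} {r : nat}
  {E : vector_bundle M r}.
Implicit Types (X Y : Sec E) (f g : Cinf M).

Lemma SecD X Y x : (X + Y) x = X x + Y x. Proof. by []. Qed.
Lemma SecZ (a : R) X x : (a *: X) x = a *: X x. Proof. by []. Qed.
Lemma SecM f X x : (f *s X) x = f x *: X x. Proof. by []. Qed.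
Lemma Sec0 x : (0 : Sec E) x = 0. Proof. by []. Qed.
Lemma SecN X x : (- X) x = - X x.
Proof. by rewrite -scaleN1r. Qed.

Lemma secMDl f g X : (f + g) *s X = f *s X + g *s X.
Proof. by apply: SecP => x; rewrite SecD !SecM CinfD scalerDl. Qed.

Lemma secMA f g X : f *s (g *s X) = (f * g) *s X.
Proof. by apply: SecP => x; rewrite !SecM CinfM scalerA. Qed.

Lemma secMZ (a : R) f X : (a *: f) *s X = a *: (f *s X).
Proof. by apply: SecP => x; rewrite SecZ !SecM CinfZ scalerA. Qed.

Lemma sec1M X : 1 *s X = X.
Proof. by apply: SecP => x; rewrite SecM Cinf1 scale1r. Qed.

Lemma tinv_sum (t : trivialization r E) x : tdom t x ->
  forall w : 'rV[R]_r, tinv t x w = \sum_i w 0 i *: tinv t x (delta_mx 0 i).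
Proof.
move=> tx w; rewrite -[RHS](tmapK tx) linear_sum; congr (tinv t x _).
rewrite [LHS]row_sum_delta; apply: eq_bigr => i _.
by rewrite linearZ tinvK.
Qed.

Lemma bump_section (t : trivialization r E) (f : Cinf M) (K : set M)
    (w : 'rV[R]_r) :
  trivs t -> closed K -> K `<=` tdom t -> (forall x, ~ K x -> f x = 0) ->
  exists X : Sec E, forall x, X x = f x *: tinv t x w.
Proof.
move=> tt cK Kt f0.
have sX : smooth_section (fun x => f x *: tinv t x w : E x).
  move=> s st j; apply: smooth_in_local => x sx.
  have [Kx|Kx] := pselect (K x).
    have oD : open (tdom s `&` tdom t) by apply: openI; exact: tdom_open.
    exists (tdom s `&` tdom t); split => //; first by split => //; exact: Kt.
    have sS : smooth_in (tdom s `&` tdom t) (\sum_i (cst (w 0 i) *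
        (fun x => tmap s x (tinv t x (delta_mx 0 i)) 0 j))).
      elim/big_ind : _ => [|F G|i _]; [exact: smooth_in_cst|exact: smooth_inD|].
      apply: smooth_inM => //; first exact: smooth_in_cst.
      by rewrite setIC; exact: trivs_smooth.
    have sf : smooth_in (tdom s `&` tdom t) f.
      exact: Cinf_smooth_sub.
    apply: eq_smooth_in (smooth_inM oD sf sS) => // y; rewrite inE => -[sy ty].
    rewrite linearZ mxE (tinv_sum ty) linear_sum summxE /= fct_sumE.
    congr (_ * _); apply: eq_bigr => i _.
    by rewrite linearZ mxE.
  have oD : open (tdom s `&` ~` K).
    by apply: openI; [exact: tdom_open|exact: closed_openC].
  exists (tdom s `&` ~` K); split => //.
  apply: (@eq_smooth_in _ _ _ _ (cst 0)) => //; last exact: smooth_in_cst.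
  move=> y; rewrite inE => -[_ /f0 ->].
  by rewrite scale0r linear0 mxE.
by exists (MkSec sX).
Qed.

Lemma section_at p (u : E p) : exists X : Sec E, X p = u.
Proof.
have [t tt tp] := trivs_cover E p.
have [f [V [K [[_ Vp _ f1] [cK Kt f0]]]]] := Cinf_bump (@tdom_open _ _ _ _ t) tp.
have [X XE] := bump_section (tmap t p u) tt cK Kt f0.
by exists X; rewrite XE f1// scale1r tmapK.
Qed.

End bundle_sections.

Section line_bundle.
Context {R : realType} {n : nat} {M : manifold R n}
  {E : vector_bundle M 1}.

(** The frame and the coefficients are global objects with the right values on [V], so the bracket
    applies to them directly. *)
Lemma local_frame p (U : set M) : open U -> U p -> exists V (e : Sec E),
  [/\ open V, V p, V `<=` U, forall x, V x -> e x != 0 &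
      forall X : Sec E, exists f : Cinf M, forall x, V x -> X x = f x *: e x].
Proof.
move=> oU Up; have [t tt tp] := trivs_cover E p.
have oD : open (tdom t) by exact: tdom_open.
have [f [V [K [[oV Vp VU f1] [cK Kt f0]]]]] := Cinf_bump (openI oU oD) (conj Up tp).
have {}Kt : K `<=` tdom t by move=> x /Kt[].
have [e eE] := bump_section (delta_mx 0 0) tt cK Kt f0.
have {}eE x : V x -> e x = tinv t x (delta_mx 0 0).
  by move=> Vx; rewrite eE f1// scale1r.
exists V, e; split => //.
- by move=> x /VU[].
- move=> x Vx; have [_ tx] := VU _ Vx; rewrite eE//.
  apply/eqP => /(congr1 (tmap t x)); rewrite tinvK// linear0.
  by move=> /matrixP/(_ 0 0); rewrite !mxE => /eqP; rewrite oner_eq0.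
- move=> X.
  have [g gE] := Cinf_extend oD cK Kt f0 (Sec_smooth X tt 0).
  exists g => x Vx; have [_ tx] := VU _ Vx.
  by rewrite gE f1// mul1r eE// -[LHS](tmapK tx) (tinv_sum tx) big_ord1.
Qed.

End line_bundle.

(** * Quasi-derivations and Lie algebroids *)

Section section_forms.
Context {R : realType} {n : nat} {M : manifold R n} {r : nat}
  {E : vector_bundle M r}.
Implicit Types (X Y : Sec E) (f g : Cinf M).

Lemma fiber_formP x (u v : E x) :
  (forall phi : E x -> R, {morph phi : u v / u + v} -> {morph phi : u / - u} ->
     (forall a u, phi (a *: u) = a * phi u) -> phi u = phi v) -> u = v.
Proof.
move=> uv; have [t tt tx] := trivs_cover E x.
rewrite -[u](tmapK tx) -[v](tmapK tx); congr (tinv t x _).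
apply/rowP => j; apply: (uv (fun u => tmap t x u 0 j)).
- by move=> a b; rewrite linearD mxE.
- by move=> a; rewrite linearN mxE.
- by move=> a b; rewrite linearZ mxE.
Qed.

End section_forms.

(* Reduces an identity between sections to a ring identity between the values of
   a linear form on the fibers. *)
Ltac section_ring :=
  let x := fresh "x" in let phi := fresh "phi" in let phiD := fresh "phiD" in
  let phiN := fresh "phiN" in let phiZ := fresh "phiZ" in
  apply: SecP => x; apply: fiber_formP => phi phiD phiN phiZ;
  rewrite ?(SecD, SecN, SecM, SecZ, CinfD, CinfM, CinfN, CinfZ, phiD, phiN, phiZ);
  ring.

Section brackets.
Context {R : realType} {n : nat} {M : manifold R n} {r : nat}
  {E : vector_bundle M r}.
Implicit Types (X Y Z : Sec E) (f g : Cinf M).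
Variable br : Sec E -> Sec E -> Sec E.
Hypothesis brL : Lie_bracket br.

Lemma brDr X Y Z : br X (Y + Z) = br X Y + br X Z.
Proof. by have [/(_ X 1 Y Z) + _ _ _] := brL; rewrite !scale1r. Qed.

Lemma brDl X Y Z : br (X + Y) Z = br X Z + br Y Z.
Proof. by have [_ /(_ Z 1 X Y) + _ _] := brL; rewrite !scale1r. Qed.

Lemma br0r X : br X 0 = 0.
Proof. by apply: (addrI (br X 0)); rewrite -brDr !addr0. Qed.

Lemma br0l X : br 0 X = 0.
Proof. by apply: (addrI (br 0 X)); rewrite -brDl !addr0. Qed.

Lemma brZr (a : R) X Y : br X (a *: Y) = a *: br X Y.
Proof. by have [/(_ X a Y 0) + _ _ _] := brL; rewrite br0r !addr0. Qed.

Lemma brZl (a : R) X Y : br (a *: X) Y = a *: br X Y.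
Proof. by have [_ /(_ Y a X 0) + _ _] := brL; rewrite br0l !addr0. Qed.

Lemma brNr X Y : br X (- Y) = - br X Y.
Proof. by rewrite -scaleN1r brZr scaleN1r. Qed.

Lemma brNl X Y : br (- X) Y = - br X Y.
Proof. by rewrite -scaleN1r brZl scaleN1r. Qed.

Lemma brC X Y : br X Y = - br Y X.
Proof.
have [_ _ brXX _] := brL; apply/eqP; rewrite -addr_eq0; apply/eqP.
by have := brXX (X + Y); rewrite brDl !brDr !brXX add0r addr0.
Qed.

Lemma br_jacobi X Y Z : br (br X Y) Z = br X (br Y Z) - br Y (br X Z).
Proof.
have [_ _ _ /(_ X Y Z)] := brL.
rewrite [br Z (br X Y)]brC [br Z X]brC brNr => /eqP; rewrite subr_eq0 => /eqP.
by move=> <-.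
Qed.

Lemma quasi_derivationC : (forall X, quasi_derivation (br X)) ->
  forall Y, quasi_derivation (br^~ Y).
Proof.
move=> qd Y; split; first by have [_ + _ _] := brL; apply.
move=> f; have [_ /(_ f)[Df DfE]] := qd Y; exists (- Df) => X.
by rewrite brC DfE (brC X); section_ring.
Qed.

End brackets.

Section Lie_algebroids.
Context {R : realType} {n : nat} {M : manifold R n} {r : nat}
  {E : vector_bundle M r}.
Implicit Types (X Y Z : Sec E) (f g : Cinf M) (br : Sec E -> Sec E -> Sec E).

Lemma Lie_algebroid_QD br : Lie_algebroid br -> Lie_QD_algebroid br.
Proof.
move=> [brL [a [_ aE _]]].
have qd X : quasi_derivation (br X).
  split; first by have [+ _ _ _] := brL; apply.
  by move=> f; exists (a X f) => Y; exact: aE.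
by split => //; exact: quasi_derivationC.
Qed.

(** Take [f] equal to 1 near [p] and supported off [supp X]. Then [f *s X = 0], and in the
    quasi-derivation rule at [p] the term [Df *s X] vanishes, leaving [br X Y p]. *)
Lemma QD_vanish br X Y p : Lie_QD_algebroid br -> ~ supp X p -> br X Y p = 0.
Proof.
move=> [brL _ qd] pX.
have oU : open (~` supp X) by apply: closed_openC; exact: closed_closure.
have [f [V [K [[_ Vp _ f1] [cK KU f0]]]]] := Cinf_bump oU pX.
have X0 x : ~ supp X x -> X x = 0.
  by move=> xX; apply: contrapT => /eqP Xx; apply/xX/subset_closure.
have fX : f *s X = 0.
  apply: SecP => x; rewrite SecM Sec0.
  have [Kx|Kx] := pselect (K x); last by rewrite f0// scale0r.
  by rewrite X0 ?scaler0//; exact: KU.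
have [_ /(_ f)[Df DfE]] := qd Y.
have := congr1 (fun Z : Sec E => Z p) (DfE X).
by rewrite fX (br0l brL) SecD !SecM (f1 _ Vp) (X0 _ pX) scaler0 addr0 scale1r.
Qed.

Lemma QD_local br : Lie_QD_algebroid br -> local_Lie_algebra br.
Proof.
move=> qd; have [brL _ _] := qd; split => // X Y.
have suppS A B Z : (forall p, ~ supp A p -> br B Z p = 0) ->
    supp (br B Z) `<=` supp A.
  move=> BA; rewrite [supp A in X in _ `<=` X](closure_id _).1; last first.
    exact: closed_closure.
  apply: closure_subset => p /= Bp; apply: contrapT => Ap.
  by rewrite BA ?eqxx in Bp.
rewrite subsetI; split; apply: suppS => p; first exact: QD_vanish.
by move=> Yp; rewrite (brC brL) SecN (QD_vanish _ qd Yp) oppr0.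
Qed.

Section rank_gt1.
Hypothesis r_gt1 : (1 < r)%N.
Variable br : Sec E -> Sec E -> Sec E.
Hypothesis brQD : Lie_QD_algebroid br.

Let brL : Lie_bracket br. Proof. by case: brQD. Qed.

(** If the first coordinate of [u] is zero the first basis vector of a trivialization will do,
    otherwise the second. *)
Lemma independent_vector x (u : E x) :
  exists v : E x, forall c d : R, c *: v = d *: u -> c = 0.
Proof.
have [t tt tx] := trivs_cover E x.
have coord c d j i : c *: tinv t x (delta_mx 0 j) = d *: u ->
    c * (i == j)%:R = d * tmap t x u 0 i.
  move=> /(congr1 (fun v => tmap t x v 0 i)).
  by rewrite !linearZ !mxE tinvK// !mxE eqxx.
pose i0 : 'I_r := Ordinal (ltnW r_gt1); pose i1 : 'I_r := Ordinal r_gt1.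
have [u0|u0] := eqVneq (tmap t x u 0 i0) 0.
- exists (tinv t x (delta_mx 0 i0)) => c d /(coord _ _ _ i0).
  by rewrite eqxx mulr1 u0 mulr0.
- exists (tinv t x (delta_mx 0 i1)) => c d cd.
  have := coord _ _ _ i0 cd; rewrite mulr0 => /esym/eqP.
  rewrite mulf_eq0 (negbTE u0) orbF => /eqP d0.
  by have := coord _ _ _ i1 cd; rewrite eqxx mulr1 d0 mul0r.
Qed.

Lemma secM_inj f g : (forall Y, f *s Y = g *s Y) -> f = g.
Proof.
move=> fg; apply: CinfP => x.
have [v vP] := independent_vector (0 : E x).
have [Y Yx] := section_at v.
have := congr1 (fun Z : Sec E => Z x) (fg Y); rewrite /= Yx => /eqP.
rewrite -subr_eq0 -scalerBl => /eqP vx; apply/eqP; rewrite -subr_eq0; apply/eqP.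
by apply: (vP _ 0); rewrite vx scaler0.
Qed.

Lemma QD_Lie_algebroid : Lie_algebroid br.
Proof.
split => //; have [_ qd _] := brQD.
have /choice[a aE] : forall X, exists aX : Cinf M -> Cinf M, forall f Y,
    br X (f *s Y) = f *s br X Y + aX f *s Y.
  by move=> X; have [_ /choice[aX aXE]] := qd X; exists aX => f Y; exact: aXE.
have aEl X Y f : br (f *s X) Y = f *s br X Y - a Y f *s X.
  by rewrite (brC brL) aE (brC brL X); section_ring.
have aS X f Y : a X f *s Y = br X (f *s Y) - f *s br X Y.
  by rewrite aE; section_ring.
have aM X f g : a (f *s X) g = f * a X g.
  apply: CinfP => x.
  have [v vP] := independent_vector (X x); have [Y Yx] := section_at v.
  have E1 : br (f *s X) (g *s Y) =
      g *s (f *s br X Y - a Y f *s X) + a (f *s X) g *s Y.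
    by rewrite aE aEl.
  have E2 : br (f *s X) (g *s Y) =
      f *s (g *s br X Y + a X g *s Y) - a (g *s Y) f *s X.
    by rewrite aEl aE.
  have E3 : (a (f *s X) g - f * a X g) *s Y = (g * a Y f - a (g *s Y) f) *s X.
    apply/eqP; rewrite -subr_eq0 -[X in _ == X](subrr (br (f *s X) (g *s Y))).
    by rewrite {1}E1 E2; apply/eqP; section_ring.
  have := congr1 (fun Z : Sec E => Z x) E3; rewrite !SecM Yx => /vP.
  by move/eqP; rewrite CinfD CinfN CinfM subr_eq0 => /eqP.
(* The remaining identities are tested on an arbitrary section: [aS] writes the action of the anchor
   through the bracket, and the Lie identities finish. *)
exists a; split => //.
- split.
    move=> X; split.
      move=> c f g; apply: secM_inj => Y.
      rewrite aS [RHS]secMDl secMZ !aS secMDl secMZ (brDr brL) (brZr brL).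
      by section_ring.
    move=> f g; apply: secM_inj => Y.
    by rewrite aS -secMA !aE; section_ring.
  move=> f X Y g; apply: secM_inj => Z.
  rewrite aS !(brDl brL) !secMDl -aM !aS; section_ring.
- move=> X Y f; apply: secM_inj => Z.
  rewrite aS !(br_jacobi brL) !aE !(brDr brL) !aE; section_ring.
Qed.

End rank_gt1.
End Lie_algebroids.

(** * Local brackets on line bundles *)

Section restriction_ring.
Context {R : realType} {n : nat} {M : manifold R n} (U : set M).

(** Only restrictions of global functions are kept, so that every element is the coefficient of a
    global section, where the bracket is defined. *)
Definition restr_pred : {pred ({x : M | U x} -> R)} :=
  [pred h | `[< exists f : Cinf M, forall s, h s = f (sval s) >]].

Lemma restr_pred_subring : subring_closed restr_pred.
Proof.
split=> [|h h' /asboolP[f fE] /asboolP[g gE]|h h' /asboolP[f fE] /asboolP[g gE]];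
  apply/asboolP.
- by exists 1.
- by exists (f - g) => s; rewrite CinfD CinfN -fE -gE.
- by exists (f * g) => s; rewrite CinfM -fE -gE.
Qed.

HB.instance Definition _ :=
  GRing.isSubringClosed.Build ({x : M | U x} -> R) restr_pred restr_pred_subring.

Record restr := Restr {
  restr_val :> {x : M | U x} -> R;
  restrP : restr_val \in restr_pred
}.

HB.instance Definition _ := [isSub of restr for restr_val].
HB.instance Definition _ := [Choice of restr by <:].
HB.instance Definition _ :=
  GRing.SubChoice_isSubComPzRing.Build _ _ restr
    (GRing.subringClosedP restr_pred).

Definition restr_eval (s : {x : M | U x}) (h : restr) : R := h s.

Lemma restr_eval_zmod s : zmod_morphism (restr_eval s).
Proof. by []. Qed.
Lemma restr_eval_monoid s : monoid_morphism (restr_eval s).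
Proof. by []. Qed.

HB.instance Definition _ s :=
  GRing.isZmodMorphism.Build restr R (restr_eval s) (restr_eval_zmod s).
HB.instance Definition _ s :=
  GRing.isMonoidMorphism.Build restr R (restr_eval s) (restr_eval_monoid s).

Lemma restr_ext (h h' : restr) : (forall s, h s = h' s) -> h = h'.
Proof. by move=> hh; apply: val_inj; apply/funext. Qed.

Lemma res_subproof (f : Cinf M) : (fun s : {x : M | U x} => f (sval s)) \in restr_pred.
Proof. by apply/asboolP; exists f. Qed.
Definition res (f : Cinf M) : restr := Restr (res_subproof f).

Lemma res_surj (h : restr) : exists f, h = res f.
Proof.
by have /asboolP[f fE] := restrP h; exists f; exact: restr_ext.
Qed.

End restriction_ring.

Section local_brackets.
Context {R : realType} {n : nat} {M : manifold R n} {E : vector_bundle M 1}.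
Implicit Types (X Y Z : Sec E) (f g : Cinf M).
Variable br : Sec E -> Sec E -> Sec E.
Hypothesis brloc : local_Lie_algebra br.

Let brL : Lie_bracket br. Proof. by case: brloc. Qed.

Lemma br_vanish (U : set M) X Y : open U -> (forall x, U x -> X x = 0) ->
  forall x, U x -> br X Y x = 0.
Proof.
move=> oU X0 x Ux; apply: contrapT => /eqP bx.
have [_ /(_ X Y x)] := brloc; case; first exact: subset_closure.
move=> Xx _; have [|y [/= + Uy]] := Xx U; first exact: open_nbhs_nbhs.
by rewrite X0 ?eqxx.
Qed.

Lemma br_agree (U : set M) X X' Y Y' : open U ->
  (forall x, U x -> X x = X' x) -> (forall x, U x -> Y x = Y' x) ->
  forall x, U x -> br X Y x = br X' Y' x.
Proof.
move=> oU XX YY x Ux; apply/eqP; rewrite -subr_eq0; apply/eqP.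
have -> : br X Y x - br X' Y' x = br (X - X') Y x - br (Y - Y') X' x.
  rewrite -!SecN -!SecD; congr (Sec_val _ x).
  rewrite (brC brL (Y - Y')) !(brDl brL, brDr brL, brNl brL, brNr brL).
  by section_ring.
rewrite (@br_vanish U) ?(@br_vanish U (Y - Y')) ?subrr// => y Uy.
  by rewrite SecD SecN YY// subrr.
by rewrite SecD SecN XX// subrr.
Qed.

(** When [f q = 0], the value at [q] of the commutator of length [k.+1] reduces to this single
    term. *)
Definition order_le k (q : M) := forall X f Y, f q = 0 ->
  br X (f ^+ k.+1 *s Y) q = 0.

Section frame.
Variables (U : set M) (e : Sec E).
Hypothesis oU : open U.
Hypothesis e_neq0 : forall x, U x -> e x != 0.
Hypothesis e_frame : forall X, exists f : Cinf M, forall x, U x -> X x = f x *: e x.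

Definition coef X : Cinf M := sval (cid (e_frame X)).
Lemma coefE X x : U x -> X x = coef X x *: e x.
Proof. exact: (svalP (cid (e_frame X))). Qed.

Definition coefU X : restr U := res U (coef X).

Lemma coefUP X (h : restr U) :
  (forall s, X (sval s) = h s *: e (sval s)) -> coefU X = h.
Proof.
move=> Xh; apply: restr_ext => s; have := Xh s.
rewrite (coefE _ (svalP s)) => /eqP; rewrite -subr_eq0 -scalerBl scaler_eq0.
by rewrite (negbTE (e_neq0 (svalP s))) orbF subr_eq0 => /eqP.
Qed.

Lemma coefUE X s : X (sval s) = coefU X s *: e (sval s).
Proof. exact/coefE/svalP. Qed.

Lemma coefU_surj (h : restr U) : exists X, coefU X = h.
Proof.
by have [f ->] := res_surj h; exists (f *s e); apply: coefUP => s.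
Qed.

Lemma coefUD X Y : coefU (X + Y) = coefU X + coefU Y.
Proof. by apply: coefUP => s; rewrite SecD (coefUE X) (coefUE Y) -scalerDl. Qed.

Lemma coefU0 : coefU 0 = 0.
Proof. by apply: coefUP => s; rewrite scale0r. Qed.

Lemma coefUN X : coefU (- X) = - coefU X.
Proof. by apply: coefUP => s; rewrite SecN (coefUE X) -scaleNr. Qed.

Lemma coefUM f X : coefU (f *s X) = res U f * coefU X.
Proof. by apply: coefUP => s; rewrite SecM (coefUE X) scalerA. Qed.

Lemma coefU_eq X Y : coefU X = coefU Y -> forall x, U x -> X x = Y x.
Proof.
move=> XY x Ux; have := coefUE X (exist _ x Ux); rewrite XY.
by rewrite -(coefUE Y (exist _ x Ux)).
Qed.

(** The bracket read in the frame. By locality the chosen lifts are immaterial, which is [brUE]. *)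
Definition brU (h h' : restr U) : restr U :=
  coefU (br (sval (cid (coefU_surj h))) (sval (cid (coefU_surj h')))).

Lemma brUE X Y : brU (coefU X) (coefU Y) = coefU (br X Y).
Proof.
apply: coefUP => s; rewrite -coefUE; apply: (br_agree oU) (svalP s).
- by apply: coefU_eq; exact: (svalP (cid (coefU_surj (coefU X)))).
- by apply: coefU_eq; exact: (svalP (cid (coefU_surj (coefU Y)))).
Qed.

Lemma brU_addr h : additive_fun (brU h).
Proof.
move=> h1 h2; have [X <-] := coefU_surj h; have [Y <-] := coefU_surj h1.
have [Z <-] := coefU_surj h2.
by rewrite -coefUD !brUE (brDr brL) coefUD.
Qed.

Lemma brU_addl h : additive_fun (brU^~ h).
Proof.
move=> h1 h2; have [X <-] := coefU_surj h; have [Y <-] := coefU_surj h1.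
have [Z <-] := coefU_surj h2.
by rewrite -coefUD !brUE (brDl brL) coefUD.
Qed.

Lemma brU_anti h h' : brU h h' = - brU h' h.
Proof.
have [X <-] := coefU_surj h; have [Y <-] := coefU_surj h'.
by rewrite !brUE -coefUN -(brC brL).
Qed.

Lemma brU_jacobi h1 h2 h3 :
  brU h1 (brU h2 h3) + brU h2 (brU h3 h1) + brU h3 (brU h1 h2) = 0.
Proof.
have [X <-] := coefU_surj h1; have [Y <-] := coefU_surj h2.
have [Z <-] := coefU_surj h3.
rewrite !brUE -!coefUD -coefU0; congr coefU.
by have [_ _ _] := brL; apply.
Qed.

Lemma iter_delta_eval (k : nat) (f : restr U) D h s : f s = 0 ->
  iter k (delta f) D h s = D (f ^+ k * h) s.
Proof.
move=> f0; elim: k D h => [|k IH] D h; first by rewrite expr0 mul1r.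
rewrite iterSr IH /delta -[LHS]/(restr_eval s _) rmorphB rmorphM.
by rewrite /= /restr_eval f0 mul0r subr0 mulrA -exprS.
Qed.

Lemma delta_cst (a : R) (h : restr U) : delta (res U (a *: (1 : Cinf M))) (brU h) = 0.
Proof.
apply/funext => h'; have [X <-] := coefU_surj h; have [Y <-] := coefU_surj h'.
rewrite /delta -coefUM !brUE -coefUM secMZ sec1M (brZr brL).
by rewrite secMZ sec1M subrr.
Qed.

Lemma iter_delta_brU k f X Y s : f (sval s) = 0 ->
  iter k (delta (res U f)) (brU (coefU X)) (coefU Y) s = coefU (br X (f ^+ k *s Y)) s.
Proof.
move=> fs; have fs' : res U f s = 0 by [].
rewrite (iter_delta_eval _ _ _ fs').
have -> : res U f ^+ k * coefU Y = coefU (f ^+ k *s Y).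
  rewrite coefUM; congr (_ * _); elim: k => [|k IH].
    by rewrite !expr0; apply: restr_ext.
  by rewrite !exprS IH; apply: restr_ext.
by rewrite brUE.
Qed.

Lemma order_le_eval k f X Y s : order_le k (sval s) ->
  iter k.+1 (delta (res U f)) (brU (coefU X)) (coefU Y) s = 0.
Proof.
move=> ks; have Us := svalP s.
(* Subtracting a constant makes the function vanish at [s]; commutators with constants are zero by
   real bilinearity. *)
pose g := f - f (sval s) *: (1 : Cinf M).
have gs : g (sval s) = 0 by rewrite CinfD CinfN CinfZ Cinf1 mulr1 subrr.
have fE : res U f = res U g + res U (f (sval s) *: (1 : Cinf M)).
  apply: restr_ext => t.
  change (f (sval t) = g (sval t) + (f (sval s) *: (1 : Cinf M)) (sval t)).
  by rewrite /g CinfD CinfN subrK.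
have -> : iter k.+1 (delta (res U f)) (brU (coefU X)) =
    iter k.+1 (delta (res U g)) (brU (coefU X)).
  elim: k.+1 => //= m ->; rewrite fE deltaDl; last first.
    by apply: iter_delta_additive; exact: brU_addr.
  by rewrite -[X in _ + X]iter_delta_deltaC delta_cst iter_delta0 addr0.
rewrite iter_delta_brU//; apply/eqP.
have := coefUE (br X (g ^+ k.+1 *s Y)) s.
rewrite ks// => /esym/eqP; rewrite scaler_eq0.
by rewrite (negbTE (e_neq0 Us)) orbF.
Qed.

Lemma order_le_frame k : (forall q, U q -> order_le k.+1 q) ->
  forall f X Y q, U q ->
  br X (f *s (f *s Y)) q - f q *: br X (f *s Y) q -
    f q *: (br X (f *s Y) q - f q *: br X Y q) = 0.
Proof.
move=> kU f X Y q Uq.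
have H2 : forall f x : restr U, iter k.+2 (delta f) (brU x) = 0.
  move=> h x; have [X' <-] := coefU_surj x; have [f' ->] := res_surj h.
  apply/funext => y; have [Y' <-] := coefU_surj y.
  apply: restr_ext => s.
  exact: order_le_eval (kU _ (svalP s)).
have := @order_le1 R (restr U) _ (fun s => @restr_eval R n M U s) _ brU
   brU_addl brU_addr brU_anti brU_jacobi k H2 (res U f) (coefU X).
move=> /(_ (fun a a0 => @restr_ext R n M U a 0 a0))/(congr1 (fun D => D (coefU Y))) => E2.
pose S := br X (f *s (f *s Y)) - f *s br X (f *s Y) -
   f *s (br X (f *s Y) - f *s br X Y).
transitivity (S q); first by rewrite !(SecD, SecN, SecM).
have S0 : coefU S = 0.
  by rewrite /S !(coefUD, coefUN, coefUM) -!brUE !coefUM; exact: E2.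
by apply: etrans (coefUE S (exist _ q Uq)) _; rewrite S0 scale0r.
Qed.

End frame.
End local_brackets.

Section continuity.
Context {R : realType} {n : nat} {M : manifold R n}.

Lemma Cinf_cinv_smooth (f : Cinf M) c : atlas c -> smooth_on (cimg c) (f \o cinv c).
Proof. by move=> ac; apply: smooth_on_subset (Cinf_smooth_in f ac). Qed.

Lemma Cinf_continuous (f : Cinf M) : continuous f.
Proof.
move=> x; have [c ac cx] := atlas_cover x.
have near_eq : \forall y \near x, (f \o cinv c) (cmap c y) = f y.
  have : nbhs x (cdom c) by apply: open_nbhs_nbhs; split => //; exact: cdom_open.
  by apply: filterS => y cy; rewrite /= cmapK ?inE.
have cg : {for x, continuous ((f \o cinv c) \o cmap c)}.
  apply: continuous_comp; first by apply: cmap_continuous; rewrite inE.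
  apply: smooth_on_continuous (Cinf_cinv_smooth f ac) _ _; exact: cmap_img.
change (f @ x --> f x).
rewrite -(nbhs_singleton near_eq); apply: cvg_trans cg.
exact: (@near_eq_cvg _ _ (nbhs x) _ _ _ near_eq).
Qed.

End continuity.

(** * Finiteness of the order near every point *)

Section peetre.
Context {R : realType} {n : nat} {M : manifold R n} {E : vector_bundle M 1}.
Implicit Types (X Y Z : Sec E) (f g : Cinf M) (c : chart R n M).
Variable br : Sec E -> Sec E -> Sec E.
Hypothesis brloc : local_Lie_algebra br.

Let brL : Lie_bracket br. Proof. by case: brloc. Qed.

(** The coefficient [w] of the iterated commutator is continuous and vanishes on [V] except possibly
    at [p]. If [w p != 0], then [p] is isolated, so [f ^+ k.+1 *s Y] vanishes on a neighborhood of
    [p] and locality forces the bracket to vanish there. *)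
Lemma order_le_punctured k p (U : set M) : open U -> U p ->
  (forall q, U q -> q != p -> order_le br k q) -> order_le br k p.
Proof.
move=> oU Up Uk X f Y fp; apply: contrapT => /eqP bp.
have [V [e [oV Vp VU e0 eV]]] := @local_frame _ _ _ E _ _ oU Up.
pose h := iter k.+1 (delta (res V f)) (brU br e0 eV (coefU eV X)) (coefU eV Y).
have [w hw] := res_surj h.
have wp : w p != 0.
  have := @iter_delta_brU _ _ _ _ br brloc V e oV e0 eV k.+1 f X Y (exist _ p Vp) fp.
  rewrite -/h hw => /= ->; apply: contra bp => /eqP wp.
  have := coefUE eV (br X (f ^+ k.+1 *s Y)) (exist _ p Vp).
  by rewrite /= wp scale0r => ->.
pose W := V `&` w @^-1` [set t | t != 0].
have oW : open W.
  apply: openI => //; apply: open_comp; last exact: open_neq.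
  by move=> x _; exact: Cinf_continuous.
have Wp x : W x -> x = p.
  move=> [Vx wx]; apply: contrapT => /eqP xp; move/eqP: wx; apply.
  have := @order_le_eval _ _ _ _ br brloc V e oV e0 eV k f X Y (exist _ x Vx).
  by rewrite -/h hw; apply; apply: Uk => //; exact: VU.
move/eqP: bp; apply; rewrite (brC brL) SecN (@br_vanish _ _ _ _ br brloc W) ?oppr0//.
by move=> x /Wp ->; rewrite SecM exprS CinfM fp mul0r scale0r.
Qed.

(* Near [cinv c q] the sections modelled on [v] and [u] are multiples of [X] and
   [f ^+ k.+1 *s Y], where [X], [f], [Y] witness the failure of [order_le]. *)
Lemma bad_point_model c (V : set M) (e : Sec E) k (q : 'rV[R]_n) (r eta : R) :
  atlas c -> open V -> (forall x, V x -> e x != 0) ->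
  (forall X, exists f, forall x, V x -> X x = f x *: e x) ->
  0 < r -> (forall v, `|v - q| <= r -> cimg c v /\ V (cinv c v)) ->
  0 < eta -> ~ order_le br k (cinv c q) ->
  exists v u : 'rV[R]_n -> R,
  [/\ smooth_on setT v /\ smooth_on setT u,
      forall x, r < `|x - q| -> v x = 0 /\ u x = 0,
      dbound k eta v /\ dbound k eta u &
      forall SX SY : Sec E,
      (forall x, `|x - q| <= r -> SX (cinv c x) = v x *: e (cinv c x)) ->
      (forall x, `|x - q| <= r -> SY (cinv c x) = u x *: e (cinv c x)) ->
      br SX SY (cinv c q) = k.+1%:R *: e (cinv c q)].
Proof.
move=> ac oV e0 eV r0 rP eta0 /existsNP[X /existsNP[f /existsNP[Y]]].
move=> /not_implyP[fq /eqP bq].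
have [beta [sb [s s0 b1] b0]] := smooth_bump q r0.
have qq : `|q - q| <= r by rewrite subrr normr0 ltW.
have [cq Vq] := rP _ qq.
have cut g : csmooth (fun x => g (cinv c x) * beta x).
  apply: (smooth_cutoff (U := cimg c)) sb b0 _ => //.
  - exact: cimg_open.
  - by move=> x /rP[].
  - exact: Cinf_cinv_smooth.
pose xi := coef eV X; pose yi := coef eV Y.
have [a a0 va] := csmooth_small k (cut xi) eta0.
pose w := coef eV (br X (f ^+ k.+1 *s Y)) (cinv c q).
have w0 : w != 0.
  apply: contra bq => /eqP wq; rewrite (coefE eV _ Vq).
  by rewrite -/w wq scale0r.
(* Normalizes the bracket: with scalings [a] and [d] its coefficient at [q] is
   [a * d * w = k.+1]. *)
pose d := k.+1%:R / (a * w).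
have [sf _] := cut f.
have fq0 : f (cinv c q) * beta q = 0 by rewrite fq mul0r.
have [u [su u0 ud [t t0 tu]]] := small_power k d sf (cut yi) fq0 eta0.
exists (fun x => a * (xi (cinv c x) * beta x)), u; split.
- split => //; apply: smooth_onZ; first exact: openT.
  by case: (cut xi).
- move=> x /ltW xr; split; first by rewrite b0// !mulr0.
  by apply: u0; rewrite b0// mulr0.
- by [].
move=> SX SY SXE SYE.
pose m := Num.min r (Num.min s t).
have m0 : 0 < m by rewrite !lt_min r0 s0 t0.
pose O := cdom c `&` cmap c @^-1` [set x | `|x - q| < m].
have oO : open O by apply: open_cmap_preimage; exact: open_dist_lt.
have Oq : O (cinv c q).
  split; first exact: cinv_dom.
  by rewrite /= cinvK ?inE// subrr normr0.
have Ox x : O x -> [/\ cinv c (cmap c x) = x, `|cmap c x - q| <= r,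
   beta (cmap c x) = 1 & u (cmap c x) = d * (f x ^+ k.+1 * yi x)].
  move=> [cx]; rewrite /= !lt_min => /and3P[xr xs xt].
  have b1x := b1 _ xs; split => //; first by rewrite cmapK// inE.
    exact: ltW.
  by rewrite tu// b1x !mulr1 cmapK// inE.
have SXO x : O x -> SX x = (a *: X) x.
  move=> /Ox[xx xr b1x _]; have := SXE _ xr; rewrite xx b1x mulr1 => ->.
  have [_] := rP _ xr; rewrite xx => Vx.
  by rewrite SecZ (coefE eV X Vx) scalerA.
have SYO x : O x -> SY x = (d *: (f ^+ k.+1 *s Y)) x.
  move=> /Ox[xx xr b1x ux]; have := SYE _ xr; rewrite xx ux => ->.
  have [_] := rP _ xr; rewrite xx => Vx.
  have fX j : (f ^+ j) x = f x ^+ j.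
    by elim: j => // j IH; rewrite !exprS CinfM IH.
  by rewrite SecZ SecM (coefE eV Y Vx) !scalerA fX mulrA.
rewrite (br_agree brloc oO SXO SYO Oq) (brZl brL) (brZr brL) !SecZ.
rewrite (coefE eV _ Vq) -/w !scalerA; congr (_ *: _).
by rewrite /d; field; rewrite w0 gt_eqF.
Qed.

Lemma order_le_near p : exists U k, [/\ open U, U p &
  forall q, U q -> order_le br k q].
Proof.
apply: contrapT => /forallNP bad.
(* Bad points can be taken distinct from [p], so that disjoint shells around [z] separate them. *)
have {}bad U k : open U -> U p -> exists q, [/\ U q, q != p & ~ order_le br k q].
  move=> oU Up; apply: contrapT => /forallNP good.
  have Uk q : U q -> q != p -> order_le br k q.
    by move=> Uq qp; apply: contrapT => qk; apply: (good q).
  have /forallNP/(_ k) := bad U; apply; split => // q Uq.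
  have [->|qp] := eqVneq q p; first exact: (order_le_punctured oU).
  exact: Uk.
have [c ac cp] := atlas_cover p.
have [V0 [e [oV0 V0p _ e0 eV0]]] := @local_frame _ _ _ E p setT openT I.
have oV1 : open (V0 `&` cdom c) by apply: openI => //; exact: cdom_open.
have [chi [V [K [[oV Vp VV0 chi1] [cK KV chi0]]]]] := Cinf_bump oV1 (conj V0p cp).
have [rho rho0 rhoP] := chart_ball oV cp Vp.
set z := cmap c p in rhoP.
(* Transports a smooth function on R^n to a section near [p], using the cutoff [chi]. *)
have iota w : smooth_on setT w -> exists X : Sec E, forall x,
    `|x - z| <= rho -> X (cinv c x) = w x *: e (cinv c x).
  move=> sw.
  have Kc : K `<=` cdom c by move=> x /KV[].
  have [g gE] := Cinf_extend (@cdom_open _ _ _ c) cK Kc chi0 (smooth_in_cmap ac sw).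
  exists (g *s e) => x /rhoP[cx Vx].
  by rewrite SecM gE chi1// mul1r /= cinvK// inE.
have /choice[P PP] : forall ka : nat * R, exists v, 0 < ka.2 -> ka.2 <= rho ->
    0 < `|v - z| < ka.2 /\ ~ order_le br ka.1 (cinv c v).
  move=> [k a] /=; have [a0|a0] := ltP 0 a; last by exists 0.
  have oU : open (cdom c `&` cmap c @^-1` [set x | `|x - z| < a]).
    by apply: open_cmap_preimage; exact: open_dist_lt.
  have Up : (cdom c `&` cmap c @^-1` [set x | `|x - z| < a]) p.
    by split => //=; rewrite subrr normr0.
  have [q [[cq qa] qp qk]] := bad _ k oU Up.
  exists (cmap c q) => _ _; rewrite cmapK ?inE//; split => //.
  rewrite qa andbT normr_gt0 subr_eq0; apply: contra qp => /eqP qz.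
  by rewrite -(cmapK (mem_set cq)) qz cmapK// inE.
(* Each radius is half the distance from [z] to the bad point found within the previous radius; so
   [q k] lies strictly inside its shell, and the radii at least halve. *)
pose a := fix a (k : nat) : R :=
  if k is k'.+1 then `|P (k', a k') - z| / 2 else rho.
pose q k := P (k, a k).
have aS k : a k.+1 = `|q k - z| / 2 by [].
have a_bound k : 0 < a k /\ a k <= rho.
  elim: k => [|k [ak0 akr]]; first by rewrite /= lexx.
  have [/andP[q0 qa] _] := PP (k, a k) ak0 akr; rewrite aS.
  split; first by rewrite divr_gt0.
  rewrite ler_pdivrMr// (le_trans (ltW qa))// (le_trans akr)//.
  by rewrite ler_peMr ?ler1n // ltW.
have a_gt0 k : 0 < a k by case: (a_bound k).
have q_bound k : 0 < `|q k - z| < a k by case: (a_bound k) => ? ?; case: (PP (k, a k)).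
have q_bad k : ~ order_le br k (cinv c (q k)).
  by case: (a_bound k) => ? ?; case: (PP (k, a k)).
have aS_le k : a k.+1 <= a k / 2.
  by rewrite aS ler_wpM2r// ltW//; case/andP: (q_bound k).
have a_decr k : a k.+1 <= a k.
  by rewrite (le_trans (aS_le k))// ler_pdivrMr// ler_peMr ?ler1n// ltW.
have a_geo k : a k <= rho / 2 ^+ k.
  elim: k => [|k IH]; first by rewrite expr0 divr1.
  by rewrite (le_trans (aS_le k))// exprSr invfM mulrA ler_wpM2r.
have a_cvg0 (eps : R) : 0 < eps -> exists k, a k < eps.
  move=> eps0; exists (Num.bound (rho / eps)); set k := Num.bound _.
  apply: le_lt_trans (a_geo k) _.
  rewrite ltr_pdivrMr ?exprn_gt0// mulrC -ltr_pdivrMr//.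
  apply: lt_le_trans (archi_boundP _) _; first by rewrite divr_ge0 ?ltW.
  by rewrite -natrX ler_nat ltnW// ltn_expl.
have /choice[r rP] : forall k, exists r, 0 < r /\
    forall x, `|x - q k| <= r -> a k.+1 < `|x - z| < a k.
  move=> k; have /andP[q0 qa] := q_bound k.
  (* Since [|q k - z|] is twice [a k.+1], this is half the distance from [q k] to the nearer wall of
     its shell. *)
  exists (Num.min (a k.+1) (a k - `|q k - z|) / 2); split.
    by rewrite divr_gt0// lt_min a_gt0 subr_gt0.
  move=> x; rewrite ler_pdivlMr// le_min => /andP[x1 x2].
  have := ler_normD (x - q k) (q k - z); rewrite addrA subrK.
  have := ler_normD (q k - x) (x - z); rewrite addrA subrK (distrC (q k) x).
  move: x1 x2; rewrite aS; move: q0 qa.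
  move: `|x - q k| `|q k - z| `|x - z| (a k) (normr_ge0 (x - q k)) => A B C D A0.
  by move=> ? ? ? ? ? ?; apply/andP; split; lra.
have r_gt0 k : 0 < r k by case: (rP k).
have shell k : forall x, `|x - q k| <= r k -> a k.+1 < `|x - z| < a k.
  by case: (rP k).
have qr_rho k x : `|x - q k| <= r k -> `|x - z| <= rho.
  by move=> /shell/andP[_ /ltW xa]; rewrite (le_trans xa)//; case: (a_bound k).
have V0e x : V x -> e x != 0 by move=> /VV0[/e0].
have eV X : exists f, forall x, V x -> X x = f x *: e x.
  by have [f fE] := eV0 X; exists f => x /VV0[/fE].
have /choice[vu vuP] : forall k, exists vu : ('rV[R]_n -> R) * ('rV[R]_n -> R),
  [/\ smooth_on setT vu.1 /\ smooth_on setT vu.2,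
      forall x, r k < `|x - q k| -> vu.1 x = 0 /\ vu.2 x = 0,
      dbound k (a k.+1 / k.+1%:R) vu.1 /\ dbound k (a k.+1 / k.+1%:R) vu.2 &
      forall SX SY : Sec E,
      (forall x, `|x - q k| <= r k -> SX (cinv c x) = vu.1 x *: e (cinv c x)) ->
      (forall x, `|x - q k| <= r k -> SY (cinv c x) = vu.2 x *: e (cinv c x)) ->
      br SX SY (cinv c (q k)) = k.+1%:R *: e (cinv c (q k))].
  move=> k; have eta0 : 0 < a k.+1 / k.+1%:R by rewrite divr_gt0.
  have ball v : `|v - q k| <= r k -> cimg c v /\ V (cinv c v).
    by move=> /qr_rho/rhoP.
  have [v [u vuk]] := bad_point_model ac oV V0e eV (r_gt0 k) ball eta0 (q_bad k).
  by exists (v, u).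
have [v sv vE] : exists2 v, smooth_on setT v &
    forall k x, `|x - q k| <= r k -> v x = (vu k).1 x.
  apply: (interpolation a_gt0 a_decr a_cvg0 shell) => k.
  - by have [[]] := vuP k.
  - by move=> x xr; have [_ /(_ x xr)[]] := vuP k.
  - by have [_ _ []] := vuP k.
have [u su uE] : exists2 u, smooth_on setT u &
    forall k x, `|x - q k| <= r k -> u x = (vu k).2 x.
  apply: (interpolation a_gt0 a_decr a_cvg0 shell) => k.
  - by have [[]] := vuP k.
  - by move=> x xr; have [_ /(_ x xr)[]] := vuP k.
  - by have [_ _ []] := vuP k.
have [SX SXE] := iota _ sv; have [SY SYE] := iota _ su.
have [w wE] := eV (br SX SY).
have wq k : w (cinv c (q k)) = k.+1%:R.
  have qq : `|q k - q k| <= r k by rewrite subrr normr0 ltW.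
  have [_ Vq] := rhoP _ (qr_rho k _ qq).
  have brq : br SX SY (cinv c (q k)) = k.+1%:R *: e (cinv c (q k)).
    have [_ _ _] := vuP k; apply => x xr; have xrho := qr_rho k _ xr.
      by rewrite SXE// (vE _ _ xr).
    by rewrite SYE// (uE _ _ xr).
  move/eqP: brq; rewrite (wE _ Vq) -subr_eq0 -scalerBl scaler_eq0.
  by rewrite (negbTE (V0e _ Vq)) orbF subr_eq0 => /eqP.
have zz : cimg c z by exact: cmap_img.
have /cvgrPdist_lt/(_ 1 ltr01) :=
  smooth_on_continuous (Cinf_cinv_smooth w ac) zz.
move=> /nbhs_ballP[del /= del0 delP].
have [k0 k0P] := a_cvg0 _ del0.
(* Large enough for [q k] to be so close to [z] that [w] differs by less than 1 from its value at
   [z], and for [k.+1] to exclude this. *)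
pose k := maxn k0 (Num.bound (`|w (cinv c z)| + 1)).
have ak : a k < del.
  apply: le_lt_trans k0P; rewrite -(subnK (leq_maxl k0 _ : (k0 <= k)%N)).
  elim: (k - k0)%N => // i IH; exact: le_trans (a_decr _) IH.
have : `|(w \o cinv c) z - (w \o cinv c) (q k)| < 1.
  apply: delP; rewrite -ball_normE /= distrC (lt_trans _ ak)//.
  by case/andP: (q_bound k).
rewrite /= wq => wk.
have : `|k.+1%:R : R| <= `|w (cinv c z)| + 1.
  rewrite -(subrK (w (cinv c z)) k.+1%:R) (le_trans (ler_normD _ _))// addrC.
  by rewrite lerD2l distrC ltW.
apply/negP; rewrite -ltNge normr_nat.
apply: lt_le_trans (archi_boundP _) _; first by rewrite addr_ge0.
by rewrite ler_nat leqW// leq_maxr.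
Qed.

End peetre.

(** * From first order to quasi-derivations *)

Section first_order.
Context {R : realType} {n : nat} {M : manifold R n} {E : vector_bundle M 1}.
Implicit Types (X Y Z : Sec E) (f g : Cinf M).
Variable br : Sec E -> Sec E -> Sec E.
Hypothesis brloc : local_Lie_algebra br.

Let brL : Lie_bracket br. Proof. by case: brloc. Qed.

Lemma delta2_square X f Y :
  br X (f *s (f *s Y)) - f *s br X (f *s Y) -
    f *s (br X (f *s Y) - f *s br X Y) = 0.
Proof.
apply: SecP => p; have [U [k [oU Up Uk]]] := order_le_near brloc p.
have [V [e [oV Vp VU e0 eV]]] := @local_frame _ _ _ E _ _ oU Up.
have Vk q : V q -> order_le br k.+1 q.
  move=> /VU/Uk qk X' f' Y' fq; rewrite exprSr -secMA.
  exact: qk.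
by have := order_le_frame brloc oV e0 eV Vk f X Y Vp; rewrite !(SecD, SecN, SecM).
Qed.

(** Polarization of [delta2_square] at [f + g]; the mixed terms come twice, whence the factor 2. *)
Lemma delta2 X f g Y :
  br X (f *s (g *s Y)) - f *s br X (g *s Y) =
    g *s (br X (f *s Y) - f *s br X Y).
Proof.
have fg : (f + g) *s ((f + g) *s Y) =
    f *s (f *s Y) + f *s (g *s Y) + f *s (g *s Y) + g *s (g *s Y).
  by section_ring.
have Hfg := delta2_square X (f + g) Y.
rewrite fg !secMDl !(brDr brL) in Hfg.
apply/eqP; rewrite -subr_eq0; apply/eqP.
suff : (2 : R) *: (br X (f *s (g *s Y)) - f *s br X (g *s Y) -
    g *s (br X (f *s Y) - f *s br X Y)) = 0.
  by move/eqP; rewrite scaler_eq0 pnatr_eq0 => /eqP.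
have lin (A B C S : Sec E) : A = 0 -> B = 0 -> C = 0 ->
    (2 : R) *: S = A - B - C -> (2 : R) *: S = 0.
  by move=> -> -> -> ->; rewrite !subr0.
apply: (lin _ _ _ _ Hfg (delta2_square X f Y) (delta2_square X g Y)).
section_ring.
Qed.

(** By [delta2] the commutator [T] is linear over functions, so on a line bundle it is locally
    multiplication by its coefficient on a frame. These multipliers are determined pointwise,
    because the frame is nonzero, and therefore glue. *)
Lemma local_quasi_derivation X : quasi_derivation (br X).
Proof.
split; first by have [+ _ _ _] := brL; apply.
move=> f; pose T Y := br X (f *s Y) - f *s br X Y.
have loc p : exists V (e : Sec E) (h : Cinf M), [/\ open V, V p,
    forall x, V x -> e x != 0 & forall x, V x -> forall Y, T Y x = h x *: Y x].
  have [V [e [oV Vp _ e0 eV]]] := @local_frame _ _ _ E p setT openT I.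
  exists V, e, (coef eV (T e)); split => // x Vx Y.
  pose y := coef eV Y.
  have Yy z : V z -> Y z = (y *s e) z by move=> Vz; rewrite SecM; exact: coefE.
  (* [Y] equals [y *s e] only on [V]; locality allows the replacement. *)
  have -> : T Y x = T (y *s e) x.
    rewrite /T !SecD !SecN !SecM; congr (_ - _ *: _).
      by apply: (br_agree brloc oV) Vx => // z Vz; rewrite !SecM Yy.
    exact: (br_agree brloc oV) Vx.
  have -> : T (y *s e) = y *s T e by rewrite /T delta2.
  by rewrite SecM (coefE eV (T e) Vx) (Yy _ Vx) SecM !scalerA mulrC.
have /choice[D DP] : forall x, exists d : R, forall Y, T Y x = d *: Y x.
  by move=> x; have [V [e [h [_ Vx _ hT]]]] := loc x; exists (h x); exact: hT.
have [Df DfE] : exists Df : Cinf M, forall x, Df x = D x.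
  apply: Cinf_local => p; have [V [e [h [oV Vp e0 hT]]]] := loc p.
  exists V, h => // x Vx; have := hT x Vx e; rewrite DP => /eqP.
  rewrite -subr_eq0 -scalerBl scaler_eq0 (negbTE (e0 _ Vx)) orbF subr_eq0.
  by move/eqP.
exists Df => Y; apply/eqP; rewrite addrC -subr_eq; apply/eqP.
by apply: SecP => x; rewrite SecM DfE -DP.
Qed.

Lemma local_QD : Lie_QD_algebroid br.
Proof.
have qd := local_quasi_derivation.
by split => //; exact: quasi_derivationC.
Qed.

End first_order.

Theorem corollary2 (R : realType) (n : nat) (M : manifold R n) (r : nat)
    (E : vector_bundle M r) :
  ((1 < r)%N -> forall br : Sec E -> Sec E -> Sec E,
     Lie_QD_algebroid br <-> Lie_algebroid br) /\
  (r = 1%N -> forall br : Sec E -> Sec E -> Sec E,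
     Lie_QD_algebroid br <-> local_Lie_algebra br).
Proof.
split => [r1 br|r1].
  by split; [exact: QD_Lie_algebroid|exact: Lie_algebroid_QD].
move: E; rewrite r1 => E br.
by split; [exact: QD_local|exact: local_QD].
Qed.
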